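(* Let $X_Q=V(r^2-qs)\subset\mathbb{C}^4$ and define the algebraic sets $L_1=V(q,r,s)$, $S_P=V(p^2-s,\,qs-r^2)$, $S_A=V(A_h,\,qs-r^2)$ with $A_h=256-192p+48p^2-4p^3-128q-80pq+p^2q+16q^2+288r+36pr-8qr-108s$. (1) The branch locus of $g_2:X_Q\to X_Q$, $g_2(p,q,r,s)=(p^2+4q-4r,\ (q-2p+2)^2,\ (q-2p+2)(2s-p^2-4r+4q),\ (2s-p^2-4r+4q)^2)$, consists of $L_1$, $S_P$ and $S_A$ (i.e. equals their union). (2) The branch locus of $\tilde F:\mathbb{C}^3\to X_Q$, $\tilde F(x,y,z)=(x^2+y^2,\ z^2,\ z(x^2-y^2),\ (x^2-y^2)^2)$, consists of $L_1$ and $S_P$ (i.e. equals $L_1\cup S_P$).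
   Context: For a finite dominant morphism $f:X\to Y$ of irreducible complex affine varieties of equal dimension with $Y$ normal, a point $y\in Y$ is a branch point of $f$ if the number of points of $f^{-1}(y)$ is less than $\deg f$; the branch locus is the set of branch points. $X_Q$ is normal; $g_2$ is finite of degree 8. $\tilde F$ is the quotient map of $\mathbb{C}^3$ by the dihedral group $D_4\subset GL(3,\mathbb{R})$ of order 8 generated by $(x,y,z)\mapsto(-y,x,-z)$ and $(x,y,z)\mapsto(x,-y,z)$, and $g_2$ is the map induced on $X_Q\simeq\mathbb{C}^3/D_4$ by $f_2(x,y,z)=(x^2-y^2-2z,\ 2xy,\ z^2-2x^2-2y^2+2)$, i.e. $g_2\circ\tilde F=\tilde F\circ f_2$. *)

(* Defs.v *)
From HB Require Import structures.
From mathcomp Require Import all_boot all_order all_algebra.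
From mathcomp Require Import boolp classical_sets functions cardinality reals.
From mathcomp Require Import complex.
From mathcomp Require Import mpoly.
From mathcomp Require Import ring.

Set Implicit Arguments.
Unset Strict Implicit.
Unset Printing Implicit Defensive.

Import GRing.Theory.

Local Open Scope classical_set_scope.
Local Open Scope card_scope.
Local Open Scope ring_scope.

Section AffineVarieties.
Variable R : realType.
Local Notation C := R[i].

(* The affine space C^n is n.-tuple C, and V ps is the set of common zeros
   in it of the polynomials of the sequence ps. *)
Definition V (n : nat) (ps : seq {mpoly C[n]}) : set (n.-tuple C) :=
  [set x | forall h, h \in ps -> h.@[tnth x] = 0].

Definition polymap (n m : nat) (f : m.-tuple {mpoly C[n]}) (x : n.-tuple C) :
    m.-tuple C :=
  [tuple (tnth f i).@[tnth x] | i < m].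

(* L, with rho, is a field of fractions of the coordinate ring
   C[X] = C[x_1, ..., x_n] / I(X); such an L exists iff X is irreducible. *)
Definition is_function_field (n : nat) (X : set (n.-tuple C)) (L : fieldType)
    (rho : {rmorphism {mpoly C[n]} -> L}) : Prop :=
  (forall h, rho h = 0 <-> (forall x, X x -> h.@[tnth x] = 0)) /\
  (forall z, exists a b, rho b != 0 /\ z = rho a / rho b).

(* [L : phi(K)] = d: there is a basis with d elements. *)
Definition has_ext_degree (K L : fieldType) (phi : {rmorphism K -> L})
    (d : nat) : Prop :=
  exists e : 'I_d -> L, forall z : L,
    exists! c : {ffun 'I_d -> K}, z = \sum_(i < d) phi (c i) * e i.

(* deg f = [C(X) : f^* C(Y)] = d, where f^* : C(Y) -> C(X) is induced by
   h |-> h \o f; that f^* is well defined on C(Y) says that f is dominant. *)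
Definition has_degree (n m : nat) (X : set (n.-tuple C)) (Y : set (m.-tuple C))
    (f : m.-tuple {mpoly C[n]}) (d : nat) : Prop :=
  exists (K L : fieldType) (rhoY : {rmorphism {mpoly C[m]} -> K})
         (rhoX : {rmorphism {mpoly C[n]} -> L}) (phi : {rmorphism K -> L}),
    [/\ is_function_field Y rhoY, is_function_field X rhoX,
        forall h, phi (rhoY h) = rhoX (h \mPo f) & has_ext_degree phi d].

Definition fiber (n m : nat) (X : set (n.-tuple C))
    (f : m.-tuple {mpoly C[n]}) (y : m.-tuple C) : set (n.-tuple C) :=
  [set x | X x /\ polymap f x = y].

Definition branch_locus (n m : nat) (X : set (n.-tuple C))
    (Y : set (m.-tuple C)) (f : m.-tuple {mpoly C[n]}) : set (m.-tuple C) :=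
  [set y | Y y /\ exists d k : nat,
     [/\ has_degree X Y f d, fiber X f y #= `I_k & (k < d)%N]].

Local Notation p := ('X_(0 : 'I_4) : {mpoly C[4]}).
Local Notation q := ('X_(1 : 'I_4) : {mpoly C[4]}).
Local Notation r := ('X_(2 : 'I_4) : {mpoly C[4]}).
Local Notation s := ('X_(3 : 'I_4) : {mpoly C[4]}).

Definition X_Q : set (4.-tuple C) := V [:: r ^+ 2 - q * s].

Definition L_1 : set (4.-tuple C) := V [:: q; r; s].

Definition S_P : set (4.-tuple C) := V [:: p ^+ 2 - s; q * s - r ^+ 2].

Definition A_h : {mpoly C[4]} :=
  256 - 192 * p + 48 * p ^+ 2 - 4 * p ^+ 3 - 128 * q - 80 * p * q
  + p ^+ 2 * q + 16 * q ^+ 2 + 288 * r + 36 * p * r - 8 * q * r - 108 * s.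

Definition S_A : set (4.-tuple C) := V [:: A_h; q * s - r ^+ 2].

Definition g_2 : 4.-tuple {mpoly C[4]} :=
  [tuple p ^+ 2 + 4 * q - 4 * r;
         (q - 2 * p + 2) ^+ 2;
         (q - 2 * p + 2) * (2 * s - p ^+ 2 - 4 * r + 4 * q);
         (2 * s - p ^+ 2 - 4 * r + 4 * q) ^+ 2].

Local Notation x := ('X_(0 : 'I_3) : {mpoly C[3]}).
Local Notation y := ('X_(1 : 'I_3) : {mpoly C[3]}).
Local Notation z := ('X_(2 : 'I_3) : {mpoly C[3]}).

Definition Ftilde : 4.-tuple {mpoly C[3]} :=
  [tuple x ^+ 2 + y ^+ 2;
         z ^+ 2;
         z * (x ^+ 2 - y ^+ 2);
         (x ^+ 2 - y ^+ 2) ^+ 2].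

Definition f_2 : 3.-tuple {mpoly C[3]} :=
  [tuple x ^+ 2 - y ^+ 2 - 2 * z;
         2 * x * y;
         z ^+ 2 - 2 * x ^+ 2 - 2 * y ^+ 2 + 2].

Lemma V1P (n : nat) (h : {mpoly C[n]}) (a : n.-tuple C) :
  V [:: h] a <-> h.@[tnth a] = 0.
Proof.
split=> [|ha k]; first by apply; rewrite inE.
by rewrite inE => /eqP ->.
Qed.

Lemma g_2_X_Q (a : 4.-tuple C) : X_Q a -> X_Q (polymap g_2 a).
Proof.
move=> _; apply/V1P.
rewrite !(mevalB, mevalM, rmorphXn, mevalXU) /= !tnth_mktuple.
rewrite !(tnth_nth 0) /=; rewrite !(mevalM, rmorphXn) /=; ring.
Qed.

Lemma Ftilde_X_Q (a : 3.-tuple C) : X_Q (polymap Ftilde a).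
Proof.
apply/V1P.
rewrite !(mevalB, mevalM, rmorphXn, mevalXU) /= !tnth_mktuple.
rewrite !(tnth_nth 0) /=; rewrite !(mevalM, rmorphXn) /=; ring.
Qed.

Lemma g_2_Ftilde (a : 3.-tuple C) :
  polymap g_2 (polymap Ftilde a) = polymap Ftilde (polymap f_2 a).
Proof.
apply: eq_from_tnth => i; rewrite !tnth_mktuple.
case: i => [[|[|[|[|//]]]] lt_i4]; rewrite !(tnth_nth 0) /=.
all: do 3 rewrite ?(mevalD, mevalN, mevalM, rmorphXn, mevalXU, rmorph1) /=
  ?tnth_mktuple ?(tnth_nth 0) /=.
all: ring.
Qed.

End AffineVarieties.

Arguments X_Q : clear implicits.
Arguments L_1 : clear implicits.
Arguments S_P : clear implicits.
Arguments S_A : clear implicits.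
Arguments g_2 : clear implicits.
Arguments Ftilde : clear implicits.
Arguments f_2 : clear implicits.

(* Main.v *)
Require Import Defs.
From HB Require Import structures.
From mathcomp Require Import all_boot all_order all_algebra.
From mathcomp Require Import boolp classical_sets functions cardinality reals.
From mathcomp Require Import complex.
From mathcomp Require Import finmap mpoly.
From mathcomp Require Import ring.

(** The degree of a map with finite fibres is computed from an explicit basis of
    the extension of function fields: polynomials [e_i] which are linearly
    independent on a generic fibre and whose span over the function field of
    the target is stable under multiplication by the coordinates form a basis.
    Both maps have degree 8, and each of their fibres is listed as a sequence of
    8 points with repetitions; the branch points are those whose list repeats.

    Write a point of [X_Q] as [(P, u^2, u v, v^2)], where [(u, v)] is determined
    up to sign.  Its fibre under [Ftilde] is the orbit of a point [(a, b, z)]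
    with [a^2 = (P + v) / 2], [b^2 = (P - v) / 2], [z = u].  A point
    [(t, q, r, s)] of its fibre under [g_2] satisfies, for one of the two
    choices of [(u, v)], [q = u + 2 t - 2], [4 r = t^2 + 4 q - P] and
    [2 s = v + 2 t^2 - P], and the equation [r^2 = q s] becomes a quartic in [t]
    of discriminant [128^2 (P + v)^2 A_h (P, u^2, u v, v^2)].  Over the two
    choices of sign this produces the factors [(P^2 - v^2)^2] and [A_h]; the two
    quartics yield disjoint sets of points unless [u = v = 0]. *)

Set Implicit Arguments.
Unset Strict Implicit.
Unset Printing Implicit Defensive.

Import GRing.Theory.

Local Open Scope classical_set_scope.
Local Open Scope card_scope.
Local Open Scope ring_scope.

(** * Function fields *)

Lemma fraction_ratio (D : idomainType) (z : {fraction D}) :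
  exists a b : D, b != 0 /\ z = tofrac a / tofrac b.
Proof.
elim/quotW: z => x; exists \n_x, \d_x; split; first exact: denom_ratioP.
have d_neq0 : tofrac \d_x != 0 :> {fraction D}.
  by rewrite tofrac_eq0 denom_ratioP.
apply: (mulIf d_neq0); rewrite divfK //.
unlock tofrac; rewrite -[LHS]FracField.pi_mul.
apply/eqmodP; rewrite /= FracField.equivfE /FracField.mulf.
by rewrite !numden_Ratio ?mulf_neq0 ?denom_ratioP ?oner_eq0 // !mulr1 mulrC.
Qed.

(** [{fraction _}] is built over an [idomainType], hence over a ring with a unit predicate and an
    inverse. Both come from classical choice, with [invD] the identity off the units, so that the
    absence of zero divisors is all that has to be assumed. *)
Lemma idomain_fractions (D : comNzRingType) :
    (forall x y : D, x * y = 0 -> (x == 0) || (y == 0)) ->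
  exists (L : fieldType) (iota : {rmorphism D -> L}), injective iota /\
    forall z, exists a b, iota b != 0 /\ z = iota a / iota b.
Proof.
move=> D_idomain.
pose unitD (x : D) := `[< exists y, y * x = 1 >].
pose invD (x : D) := if pselect (exists y, y * x = 1) is left xU then
  projT1 (cid xU) else x.
have mulVD : {in [pred x | unitD x], left_inverse 1 invD *%R}.
  by move=> x /asboolP xU; rewrite /invD; case: pselect => // xU'; case: cid.
have unitDP x y : y * x = 1 -> [pred x | unitD x] x.
  by move=> yx; apply/asboolP; exists y.
have invD_out : {in [predC [pred x | unitD x]], invD =1 id}.
  by move=> x /asboolPn nxU; rewrite /invD; case: pselect.
pose unitM := GRing.ComNzRing_hasMulInverse.Build D mulVD unitDP invD_out.
pose DU : comUnitRingType := HB.pack D unitM.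
pose domM := GRing.ComUnitRing_isIntegral.Build DU D_idomain.
pose DI : idomainType := HB.pack DU domM.
have iotaB : zmod_morphism (@tofrac DI : D -> {fraction DI}).
  exact: (rmorphB (@tofrac DI)).
have iotaM : monoid_morphism (@tofrac DI : D -> {fraction DI}).
  split; first exact: (rmorph1 (@tofrac DI)).
  exact: (rmorphM (@tofrac DI)).
pose BM := GRing.isZmodMorphism.Build D {fraction DI} (@tofrac DI) iotaB.
pose MM := GRing.isMonoidMorphism.Build D {fraction DI} (@tofrac DI) iotaM.
pose iota : {rmorphism D -> {fraction DI}} :=
  HB.pack (@tofrac DI : D -> {fraction DI}) BM MM.
exists {fraction DI}, iota; split.
  by move=> a b /eqP; rewrite (tofrac_eq (a : DI) b) => /eqP.
move=> z; have [a [b [b_neq0 ->]]] := @fraction_ratio DI z.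
by exists a, b; split=> //; rewrite -[iota b]/(tofrac (b : DI)) tofrac_eq0.
Qed.

(** The hypotheses say that [I] is a prime ideal. [L] is the fraction field of the quotient [A / I],
    and [rho] is the projection followed by the inclusion. *)
Lemma prime_fraction_field (A : comNzRingType) (I : A -> Prop) :
    ~ I 1 -> (forall a b, I a -> I b -> I (a - b)) ->
    (forall a b, I b -> I (a * b)) -> I 0 ->
    (forall a b, I (a * b) -> I a \/ I b) ->
  exists (L : fieldType) (rho : {rmorphism A -> L}),
    (forall a, rho a = 0 <-> I a) /\
    forall z, exists a b, rho b != 0 /\ z = rho a / rho b.
Proof.
move=> I1 IB IM I0 Iprime.
pose S (a : A) := `[< I a >].
have S_ideal : idealr_closed S.
  split; [exact/asboolP | exact/asboolPn|].
  move=> a u v /asboolP Iu /asboolP Iv; apply/asboolP.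
  have -> : a * u + v = a * u - (0 - v) by rewrite sub0r opprK.
  exact: IB (IM _ _ Iu) (IB _ _ I0 Iv).
have S_prime : prime_idealr_closed S.
  by move=> u v /asboolP /Iprime [] H; apply/orP; [left|right]; apply/asboolP.
pose M1 := isIdealr.Build A S S_ideal.
pose M2 := isPrimeIdealrClosed.Build A S S_prime.
pose P : prime_idealr A := HB.pack S M1 M2.
have [L [iota [iota_inj iota_frac]]] :=
  idomain_fractions (@Quotient.rquot_IdomainAxiom A P).
exists L, (iota \o \pi_{ideal_quot P}%qT); split.
  move=> a /=; have -> : I a <-> \pi_({ideal_quot P})%qT a = 0.
    rewrite -(rmorph0 \pi_({ideal_quot P})%qT).
    split=> [Ia|/eqP]; last first.
      by rewrite -Quotient.idealrBE subr0 => /asboolP.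
    by apply/eqP; rewrite -Quotient.idealrBE subr0; apply/asboolP.
  by split=> [|->]; [rewrite -{1}(rmorph0 iota) => /iota_inj | rewrite rmorph0].
move=> z; have [a [b [b_neq0 ->]]] := iota_frac z.
by exists (repr a), (repr b); rewrite /= !reprK.
Qed.

(** Since the kernels agree, [g b] is nonzero for every denominator [b], and [g a / g b] depends
    only on the fraction [rhoA a / rhoA b]. *)
Lemma fraction_field_lift (A B : comNzRingType) (K L : fieldType)
    (rhoA : {rmorphism A -> K}) (g : {rmorphism A -> L}) :
    (forall z, exists a b, rhoA b != 0 /\ z = rhoA a / rhoA b) ->
    (forall a, rhoA a = 0 <-> g a = 0) ->
  exists phi : {rmorphism K -> L}, forall a, phi (rhoA a) = g a.
Proof.
move=> fracK kerE.
have /choice [nd ndP] : forall z, exists ab : A * A,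
    rhoA ab.2 != 0 /\ z = rhoA ab.1 / rhoA ab.2.
  by move=> z; have [a [b ?]] := fracK z; exists (a, b).
have g_neq0 b : rhoA b != 0 -> g b != 0.
  by apply: contra_neq => /kerE.
(* The value is computed on a chosen fraction; [phi0E] says that any other fraction gives the same
   result. *)
pose phi0 z := g (nd z).1 / g (nd z).2.
have phi0E a b : rhoA b != 0 -> phi0 (rhoA a / rhoA b) = g a / g b.
  move=> b_neq0; rewrite /phi0; have [d_neq0 /eqP] := ndP (rhoA a / rhoA b).
  rewrite [in X in X -> _]eqr_div // -!rmorphM -subr_eq0 -rmorphB => /eqP/kerE/eqP.
  rewrite rmorphB subr_eq0 !rmorphM => /eqP gE.
  by apply/eqP; rewrite eqr_div ?g_neq0 // gE.
have phi0B : zmod_morphism phi0.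
  move=> z w; have [bz zE] := ndP z; have [bw wE] := ndP w.
  rewrite {1}zE {1}wE -mulNr addf_div // mulNr -!(rmorphM rhoA) -rmorphB phi0E.
    by rewrite rmorphB !(rmorphM g) -mulNr -addf_div ?g_neq0 // mulNr.
  by rewrite (rmorphM rhoA) mulf_neq0.
have phi0M : monoid_morphism phi0.
  split=> [|z w]; first by rewrite -[1](divr1 1) -(rmorph1 rhoA) phi0E
    ?rmorph1 ?oner_eq0 // divr1.
  have [bz zE] := ndP z; have [bw wE] := ndP w.
  rewrite {1}zE {1}wE mulf_div -!(rmorphM rhoA) phi0E.
    by rewrite !(rmorphM g) -mulf_div.
  by rewrite (rmorphM rhoA) mulf_neq0.
pose BM := GRing.isZmodMorphism.Build K L phi0 phi0B.
pose MM := GRing.isMonoidMorphism.Build K L phi0 phi0M.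
pose phi : {rmorphism K -> L} := HB.pack phi0 BM MM.
exists phi => a; rewrite -[phi _]/(phi0 _) -[rhoA a]divr1 -(rmorph1 rhoA) phi0E.
  by rewrite rmorph1 divr1.
by rewrite rmorph1 oner_eq0.
Qed.

(** * Linear algebra in a field extension *)

Section Span.
Variables (K L : fieldType) (phi : {rmorphism K -> L}).

Definition ext_span (I : finType) (e : I -> L) (z : L) : Prop :=
  exists c : I -> K, z = \sum_i phi (c i) * e i.

Definition ext_free (I : finType) (e : I -> L) : Prop :=
  forall c : I -> K, \sum_i phi (c i) * e i = 0 -> forall i, c i = 0.

Definition span_stable (I : finType) (e : I -> L) (z : L) : Prop :=
  forall w, ext_span e w -> ext_span e (z * w).

(** Expressing each basis in the other gives matrices [MB] and [MA]. By uniqueness of coordinates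
    [MB *m MA] is the identity of size [d], and it factors through dimension [d']. *)
Lemma has_ext_degree_le d d' :
  has_ext_degree phi d -> has_ext_degree phi d' -> (d <= d')%N.
Proof.
move=> [e eP] [e' eP'].
have /choice [B BP] : forall i, exists c : {ffun 'I_d' -> K},
    e i = \sum_j phi (c j) * e' j.
  by move=> i; have [c [cE _]] := eP' (e i); exists c.
have /choice [A AP] : forall j, exists c : {ffun 'I_d -> K},
    e' j = \sum_i phi (c i) * e i.
  by move=> j; have [c [cE _]] := eP (e' j); exists c.
pose MB := \matrix_(i < d, j < d') B i j; pose MA := \matrix_(j < d', i < d) A j i.
apply: (@mulmx1_min _ _ _ MB MA); apply/matrixP => i k.
have [c [_ cU]] := eP (e i).
have c1 : e i = \sum_k phi ([ffun k => (MB *m MA) i k] k) * e k.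
  rewrite {1}BP; under eq_bigr => j _ do rewrite AP big_distrr /=.
  rewrite exchange_big; apply: eq_bigr => l _; rewrite ffunE mxE rmorph_sum.
  by rewrite big_distrl; apply: eq_bigr => j _; rewrite !mxE rmorphM mulrA.
have c2 : e i = \sum_k phi ([ffun k => (1%:M : 'M[K]_d) i k] k) * e k.
  rewrite (bigD1 i) //= ffunE mxE eqxx rmorph1 mul1r big1 ?addr0 // => k'.
  by rewrite ffunE mxE eq_sym => /negPf ->; rewrite rmorph0 mul0r.
by have /ffunP/(_ k) := etrans (esym (cU _ c1)) (cU _ c2); rewrite !ffunE.
Qed.

Lemma ext_span_has_degree (I : finType) (e : I -> L) :
  ext_free e -> (forall z, ext_span e z) -> has_ext_degree phi #|I|.
Proof.
move=> e_free e_span; exists (fun i => e (enum_val i)) => z.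
have [c zE] := e_span z; exists [ffun i => c (enum_val i)].
split=> [|c' zE'].
  rewrite zE big_enum_val; apply: eq_bigr => i _.
  by rewrite ffunE.
pose c2 i := c i - c' (enum_rank i).
apply/ffunP => i; rewrite ffunE; apply/eqP; rewrite -subr_eq0; apply/eqP.
suff: \sum_i phi (c2 i) * e i = 0.
  by move=> /e_free/(_ (enum_val i)); rewrite /c2 enum_valK.
rewrite /c2; under eq_bigr => j _ do rewrite rmorphB mulrBl.
rewrite sumrB -zE zE' [X in _ - X]big_enum_val; apply/eqP; rewrite subr_eq0.
by apply/eqP; apply: eq_bigr => j _; rewrite enum_valK.
Qed.

Variables (I : finType) (e : I -> L).

Lemma ext_span_gen i : ext_span e (e i).
Proof.
exists (fun j => (j == i)%:R); rewrite (bigD1 i) //= eqxx rmorph1 mul1r.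
by rewrite big1 ?addr0 // => j /negPf ->; rewrite rmorph0 mul0r.
Qed.

Lemma ext_spanD z w : ext_span e z -> ext_span e w -> ext_span e (z + w).
Proof.
move=> [c ->] [c' ->]; exists (fun i => c i + c' i); rewrite -big_split.
by apply: eq_bigr => i _; rewrite rmorphD mulrDl.
Qed.

Lemma ext_spanZ a z : ext_span e z -> ext_span e (phi a * z).
Proof.
move=> [c ->]; exists (fun i => a * c i); rewrite big_distrr /=.
by apply: eq_bigr => i _; rewrite rmorphM mulrA.
Qed.

Lemma ext_span_sum (J : finType) (F : J -> L) :
  (forall j, ext_span e (F j)) -> ext_span e (\sum_j F j).
Proof.
move=> Fspan; apply: (big_ind (ext_span e)) => //.
  by exists (fun=> 0); rewrite big1 // => i _; rewrite rmorph0 mul0r.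
exact: ext_spanD.
Qed.

Lemma span_stable_gen z : (forall i, ext_span e (z * e i)) -> span_stable e z.
Proof.
move=> ze w [c ->]; rewrite big_distrr /=; apply: ext_span_sum => i.
by rewrite mulrCA; apply: ext_spanZ.
Qed.

Lemma span_stable_phi a : span_stable e (phi a).
Proof. by move=> w; apply: ext_spanZ. Qed.

Lemma span_stableD z w :
  span_stable e z -> span_stable e w -> span_stable e (z + w).
Proof. by move=> ze we v ve; rewrite mulrDl; apply: ext_spanD; auto. Qed.

Lemma span_stableM z w :
  span_stable e z -> span_stable e w -> span_stable e (z * w).
Proof. by move=> ze we v ve; rewrite -mulrA; auto. Qed.

Lemma span_stableN z : span_stable e z -> span_stable e (- z).
Proof.
by move=> ze; rewrite -mulN1r -(rmorphN1 phi); apply/span_stableM/ze/span_stable_phi.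
Qed.

Lemma span_stableX z k : span_stable e z -> span_stable e (z ^+ k).
Proof.
move=> ze; elim: k => [|k IHk]; first by rewrite expr0 -(rmorph1 phi);
  apply: span_stable_phi.
by rewrite exprS; apply: span_stableM.
Qed.

(* Multiplication by [b] is an injective endomorphism of the finite-dimensional
   span, hence it is onto. *)
Lemma ext_span_div b w :
  ext_free e -> span_stable e b -> b != 0 -> ext_span e w -> ext_span e (w / b).
Proof.
move=> e_free be b_neq0 [c wE].
have /choice [B BP] := fun i => be _ (ext_span_gen i).
pose M := \matrix_(i < #|I|, j < #|I|) B (enum_val i) (enum_val j).
have mulbE (v : 'rV_#|I|) : b * (\sum_i phi (v 0 i) * e (enum_val i)) =
    \sum_i phi ((v *m M) 0 i) * e (enum_val i).
  rewrite big_distrr /=.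
  under eq_bigr => i _ do rewrite mulrCA BP big_enum_val big_distrr /=.
  rewrite exchange_big; apply: eq_bigr => j _; rewrite mxE rmorph_sum big_distrl /=.
  by apply: eq_bigr => i _; rewrite !mxE rmorphM mulrA.
have free_enum (v : 'rV_#|I|) :
    \sum_i phi (v 0 i) * e (enum_val i) = 0 -> v = 0.
  move=> vE; apply/rowP => i; rewrite mxE -(enum_valK i).
  apply: (e_free (fun i => v 0 (enum_rank i))); rewrite big_enum_val; apply: etrans vE.
  by apply: eq_bigr => j _; rewrite enum_valK.
have Munit : M \in unitmx.
  rewrite -row_free_unit -kermx_eq0; apply/eqP/row_matrixP => i.
  rewrite row0; apply: free_enum; apply: (mulfI b_neq0).
  rewrite mulbE mulr0 -row_mul mulmx_ker row0.
  by rewrite big1 // => j _; rewrite mxE rmorph0 mul0r.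
pose v := (\row_i c (enum_val i)) *m invmx M.
exists (fun i => v 0 (enum_rank i)); apply: (mulfI b_neq0).
rewrite mulrCA divff // mulr1 [X in b * X]big_enum_val.
under [X in b * X]eq_bigr => j _ do rewrite enum_valK.
rewrite mulbE mulmxKV // wE big_enum_val.
by apply: eq_bigr => i _; rewrite mxE.
Qed.

End Span.

(** * Degree and fibres *)

Section Geometry.
Variable R : realType.
Local Notation C := R[i].

(** In characteristic zero the naturals below [size p] are pairwise distinct, which is one root too
    many for a nonzero [p]. *)
Lemma poly_vanish (F : numDomainType) (p : {poly F}) :
  (forall t, p.[t] = 0) -> p = 0.
Proof.
move=> p0; apply/eqP; apply/negPn/negP => p_neq0.
pose rs : seq F := [seq k%:R | k <- iota 0 (size p)].
have := @max_poly_roots _ p rs p_neq0; rewrite size_map size_iota ltnn.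
case/(_ _ _)/negP => //; first by apply/allP => t _; rewrite /root p0.
by rewrite map_inj_uniq ?iota_uniq // => i j /eqP; rewrite Num.Theory.eqr_nat => /eqP.
Qed.

Lemma horner_mmap (F : comNzRingType) n (g : 'I_n -> {poly F})
    (h : {mpoly F[n]}) t :
  (mmap polyC g h).[t] = h.@[fun i => (g i).[t]].
Proof.
rewrite /mmap mevalE horner_sum; apply: eq_bigr => m _.
rewrite hornerM hornerC /mmap1 horner_prod; congr (_ * _).
by apply: eq_bigr => i _; rewrite horner_exp.
Qed.

Lemma meval_polymap n m (f : m.-tuple {mpoly C[n]}) (h : {mpoly C[m]})
    (x : n.-tuple C) :
  (h \mPo f).@[tnth x] = h.@[tnth (polymap f x)].
Proof. by rewrite comp_mpoly_meval; apply: meval_eq => i; rewrite tnth_mktuple. Qed.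

(** A sufficient condition for irreducibility that is easy to check on the image of an affine space,
    where lines can be pushed forward. *)
Definition curve_connected n (X : set (n.-tuple C)) : Prop :=
  forall a b, X a -> X b -> exists g : 'I_n -> {poly C},
    [/\ forall i, (g i).[0] = tnth a i, forall i, (g i).[1] = tnth b i &
        forall t, X [tuple (g i).[t] | i < n]].

(** The vanishing ideal of [X] is prime: if [h1 * h2] vanishes on [X] while [h1] is nonzero at [a]
    and [h2] at [b], then along a curve from [a] to [b] two nonzero one-variable polynomials have
    product zero. *)
Lemma curve_connected_function_field n (X : set (n.-tuple C)) :
    X !=set0 -> curve_connected X ->
  exists (L : fieldType) (rho : {rmorphism {mpoly C[n]} -> L}),
    is_function_field X rho.
Proof.
move=> [x0 Xx0] Xconn; apply: prime_fraction_field.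
- by move=> /(_ _ Xx0) /eqP; rewrite meval1 oner_eq0.
- by move=> a b a0 b0 x Xx; rewrite mevalB a0 // b0 // subr0.
- by move=> a b b0 x Xx; rewrite mevalM b0 // mulr0.
- by move=> x _; rewrite meval0.
move=> h1 h2 h0; apply: contrapT => /not_orP [].
move=> /existsNP [a /not_implyP [Xa h1a]] /existsNP [b /not_implyP [Xb h2b]].
have [g [ga gb gX]] := Xconn a b Xa Xb.
have gE h t : (mmap polyC g h).[t] = h.@[tnth [tuple (g i).[t] | i < n]].
  by rewrite horner_mmap; apply: meval_eq => i; rewrite tnth_mktuple.
have /eqP : mmap polyC g h1 * mmap polyC g h2 = 0.
  by apply: poly_vanish => t; rewrite hornerM !gE -mevalM h0.
rewrite mulf_eq0 => /orP [] /eqP gh0.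
  apply: h1a; have := gE h1 0; rewrite gh0 horner0 => ->.
  by apply: meval_eq => i; rewrite tnth_mktuple ga.
apply: h2b; have := gE h2 1; rewrite gh0 horner0 => ->.
by apply: meval_eq => i; rewrite tnth_mktuple gb.
Qed.

Section Cover.
Variables (n m : nat) (X : set (n.-tuple C)) (Y : set (m.-tuple C)).
Variable f : m.-tuple {mpoly C[n]}.

(** As [f] maps [X] onto [Y], a polynomial vanishes on [Y] exactly when its composite with [f]
    vanishes on [X]. This is the equality of kernels that [fraction_field_lift] requires. *)
Lemma pullback_exists (K L : fieldType) (rhoY : {rmorphism {mpoly C[m]} -> K})
    (rhoX : {rmorphism {mpoly C[n]} -> L}) :
    is_function_field Y rhoY -> is_function_field X rhoX ->
    (forall x, X x -> Y (polymap f x)) ->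
    (forall y, Y y -> exists x, fiber X f y x) ->
  exists phi : {rmorphism K -> L},
    forall h, phi (rhoY h) = rhoX (h \mPo f).
Proof.
move=> [kerY fracY] [kerX _] XY f_surj.
apply: (@fraction_field_lift _ {mpoly C[n]} _ _ rhoY (rhoX \o comp_mpoly f)) => //.
move=> h /=; rewrite kerX kerY; split=> h0 a.
  by move=> /XY/h0; rewrite meval_polymap.
by move=> /f_surj [x [Xx <-]]; rewrite -meval_polymap h0.
Qed.

Variables (K L : fieldType) (rhoY : {rmorphism {mpoly C[m]} -> K}).
Variables (rhoX : {rmorphism {mpoly C[n]} -> L}) (phi : {rmorphism K -> L}).
Hypotheses (KY : is_function_field Y rhoY) (LX : is_function_field X rhoX).
Hypothesis phiE : forall h, phi (rhoY h) = rhoX (h \mPo f).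
Variables (I : finType) (e : I -> {mpoly C[n]}).

Lemma function_field_neq0 (h : {mpoly C[m]}) y :
  Y y -> h.@[tnth y] != 0 -> rhoY h != 0.
Proof. by move=> Yy; apply: contra_neq => /KY.1/(_ _ Yy). Qed.

Lemma common_denominator (c : I -> K) :
  exists (a : I -> {mpoly C[m]}) b, rhoY b != 0 /\
    forall i, c i = rhoY (a i) / rhoY b.
Proof.
have /choice [nd ndP] : forall i, exists ab : {mpoly C[m]} * {mpoly C[m]},
    rhoY ab.2 != 0 /\ c i = rhoY ab.1 / rhoY ab.2.
  by move=> i; have [a [b ?]] := KY.2 (c i); exists (a, b).
exists (fun i => (nd i).1 * \prod_(j | j != i) (nd j).2), (\prod_j (nd j).2).
split=> [|i]; first by rewrite rmorph_prod prodf_seq_neq0; apply/allP => j _;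
  have [] := ndP j.
have [_ ->] := ndP i; rewrite [\prod_j _](bigD1 i) //= !(rmorphM rhoY) -mulf_div.
rewrite divff ?mulr1 // rmorph_prod prodf_seq_neq0; apply/allP => j _.
by have [? _] := ndP j; apply/implyP.
Qed.

(** After clearing denominators, a relation over the function field of [Y] has polynomial
    coefficients [a i]. Restricted to the fibre over [y] it becomes a relation between constants, so
    [a i] vanishes at [y] whenever [D] does not. *)
Lemma generic_fiber_free (D : {mpoly C[m]}) :
    (exists2 y, Y y & D.@[tnth y] != 0) ->
    (forall y, Y y -> D.@[tnth y] != 0 -> forall c : I -> C,
      (forall x, fiber X f y x -> \sum_i c i * (e i).@[tnth x] = 0) ->
      forall i, c i = 0) ->
  ext_free phi (fun i => rhoX (e i)).
Proof.
move=> [y0 Yy0 Dy0] D_free c c0 i.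
have [a [b [b_neq0 cE]]] := common_denominator c.
have phib_neq0 : phi (rhoY b) != 0 by rewrite fmorph_eq0.
have : rhoX (\sum_i (a i \mPo f) * e i) = 0.
  apply: (mulIf (invr_neq0 phib_neq0)); rewrite mul0r -[RHS]c0.
  rewrite rmorph_sum big_distrl; apply: eq_bigr => j _ /=.
  by rewrite cE (rmorphM rhoX) -phiE fmorph_div mulrAC.
rewrite LX.1 => a0; rewrite cE.
suff -> : rhoY (a i) = 0 by rewrite mul0r.
(* The factor [D] takes care of the points over which nothing is known about the fibre. *)
suff /eqP : rhoY (D * a i) = 0.
  by rewrite rmorphM mulf_eq0 (negPf (function_field_neq0 Yy0 Dy0)) => /eqP.
apply/KY.1 => y Yy; rewrite mevalM.
have [->|Dy] := eqVneq D.@[tnth y] 0; first by rewrite mul0r.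
rewrite (D_free y Yy Dy (fun i => (a i).@[tnth y])) ?mulr0 // => x [Xx fx].
rewrite -[RHS](a0 x Xx) rmorph_sum; apply: eq_bigr => j _ /=.
by rewrite mevalM meval_polymap fx.
Qed.

(** The elements that stabilise the span form a ring; it contains the constants because these come
    from [K] through [phi]. *)
Lemma coordinates_span_stable :
    (forall j, span_stable phi (fun i => rhoX (e i)) (rhoX 'X_j)) ->
  forall h, span_stable phi (fun i => rhoX (e i)) (rhoX h).
Proof.
move=> Xe; elim/mpolyind => [|c k h _ _ he].
  by rewrite rmorph0 -(rmorph0 phi); apply: span_stable_phi.
rewrite rmorphD; apply: span_stableD => //.
rewrite -mul_mpolyC rmorphM; apply: span_stableM.
  by rewrite -(comp_mpolyC c f) -phiE; apply: span_stable_phi.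
rewrite mpolyXE_id rmorph_prod; apply: big_ind => [||j _].
- by rewrite -(rmorph1 phi); apply: span_stable_phi.
- by move=> *; apply: span_stableM.
by rewrite rmorphXn; apply: span_stableX.
Qed.

(** The span contains 1, hence the image of every polynomial by stability, hence every fraction by
    [ext_span_div]. *)
Lemma function_field_degree (D : {mpoly C[m]}) i0 :
    (exists2 y, Y y & D.@[tnth y] != 0) ->
    (forall y, Y y -> D.@[tnth y] != 0 -> forall c : I -> C,
      (forall x, fiber X f y x -> \sum_i c i * (e i).@[tnth x] = 0) ->
      forall i, c i = 0) ->
    e i0 = 1 ->
    (forall j, span_stable phi (fun i => rhoX (e i)) (rhoX 'X_j)) ->
  has_ext_degree phi #|I|.
Proof.
move=> D_neq0 D_free e1 Xe.
have e_free := generic_fiber_free D_neq0 D_free.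
apply: (ext_span_has_degree e_free) => z.
have [a [b [b_neq0 ->]]] := LX.2 z.
apply: ext_span_div => //; first exact: coordinates_span_stable.
rewrite -[rhoX a]mulr1 -(rmorph1 rhoX) -e1.
by apply: (coordinates_span_stable Xe a); apply: (ext_span_gen phi _ i0).
Qed.

End Cover.

(** The fibre has [size (undup s)] points, which is less than [size s] exactly when [s] repeats.
    Uniqueness of the degree enters because [branch_locus] quantifies existentially over it. *)
Lemma branch_locusP n m (X : set (n.-tuple C)) (Y : set (m.-tuple C))
    (f : m.-tuple {mpoly C[n]}) d y (s : seq (n.-tuple C)) :
    has_degree X Y f d -> (forall d', has_degree X Y f d' -> d' = d) ->
    Y y -> fiber X f y = [set` s] -> size s = d ->
  branch_locus X Y f y <-> ~~ uniq s.
Proof.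
move=> deg_d deg_uniq Yy fiberE size_s.
have fiber_card : fiber X f y #= `I_(size (undup s)).
  rewrite fiberE; have -> : [set` s] = [set` [fset x in s]%fset].
    by apply/seteqP; split=> x /=; rewrite inE.
  by apply/card_eq_fsetP; rewrite -[size _]/(#|` _|)%fset card_fseq.
split=> [[_ [d' [k [/deg_uniq -> fk kd]]]]|nuniq].
  have : `I_k #= `I_(size (undup s)).
    by apply: card_eq_trans fiber_card; rewrite card_eq_sym.
  move=> /card_eq_II ks; apply: contraTN kd => s_uniq.
  by rewrite ks undup_id // size_s ltnn.
split=> //; exists d, (size (undup s)); split=> //.
by rewrite -size_s ltn_size_undup.
Qed.

Lemma branch_locus_eq n m (X : set (n.-tuple C)) (Y S : set (m.-tuple C))
    (f : m.-tuple {mpoly C[n]}) :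
    S `<=` Y -> (forall y, Y y -> branch_locus X Y f y <-> S y) ->
  branch_locus X Y f = S.
Proof.
move=> SY H; apply/seteqP; split=> y yB; last exact/H/yB/SY.
by apply/H/yB; case: yB.
Qed.

End Geometry.

(** The formula of [A_h] over an arbitrary ring, so that it applies both to the variables and to
    their values at a point. *)
Definition discA (F : pzRingType) (p q r s : F) : F :=
  256 - 192 * p + 48 * p ^+ 2 - 4 * p ^+ 3 - 128 * q - 80 * p * q
  + p ^+ 2 * q + 16 * q ^+ 2 + 288 * r + 36 * p * r - 8 * q * r - 108 * s.
Lemma rmorph_discA (F G : pzRingType) (f : {rmorphism F -> G}) p q r s p' q' r' s' :
    f p = p' -> f q = q' -> f r = r' -> f s = s' ->
  f (discA p q r s) = discA p' q' r' s'.
Proof.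
move=> <- <- <- <-.
(* With variables in place of the literals, each coefficient is an opaque [n%:R] during the
   rewriting. *)
have numerals (a b c d e g h i j k l : nat) :
    f (a%:R - b%:R * p + c%:R * p ^+ 2 - d%:R * p ^+ 3 - e%:R * q - g%:R * p * q
      + p ^+ 2 * q + h%:R * q ^+ 2 + i%:R * r + j%:R * p * r - k%:R * q * r
      - l%:R * s) =
    a%:R - b%:R * f p + c%:R * f p ^+ 2 - d%:R * f p ^+ 3 - e%:R * f q
      - g%:R * f p * f q + f p ^+ 2 * f q + h%:R * f q ^+ 2 + i%:R * f r
      + j%:R * f p * f r - k%:R * f q * f r - l%:R * f s.
  by rewrite !(rmorphB, rmorphD, rmorphM, rmorphXn, rmorph_nat).
exact: numerals.
Qed.

(** * Degree from an explicit basis, and parametrisation of [X_Q] *)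

Section Cover.
Variable R : realType.
Local Notation C := R[i].
(** Span stability is asked for every choice of function fields, because [has_degree] leaves them
    free; the degree computed in any of them is then [#|I|], which gives uniqueness. *)
Lemma has_degree_basis n m (X : set (n.-tuple C)) (Y : set (m.-tuple C))
    (f : m.-tuple {mpoly C[n]}) (I : finType) (e : I -> {mpoly C[n]}) i0
    (D : {mpoly C[m]}) :
    curve_connected X -> curve_connected Y ->
    (forall x, X x -> Y (polymap f x)) ->
    (forall y, Y y -> exists x, fiber X f y x) ->
    (exists2 y, Y y & D.@[tnth y] != 0) ->
    (forall y, Y y -> D.@[tnth y] != 0 -> forall c : I -> C,
      (forall x, fiber X f y x -> \sum_i c i * (e i).@[tnth x] = 0) ->
      forall i, c i = 0) ->
    e i0 = 1 ->
    (forall (K L : fieldType) (rhoY : {rmorphism {mpoly C[m]} -> K})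
        (rhoX : {rmorphism {mpoly C[n]} -> L}) (phi : {rmorphism K -> L}),
      is_function_field Y rhoY -> is_function_field X rhoX ->
      (forall h, phi (rhoY h) = rhoX (h \mPo f)) ->
      forall j, span_stable phi (fun i => rhoX (e i)) (rhoX 'X_j)) ->
  has_degree X Y f #|I| /\ forall d, has_degree X Y f d -> d = #|I|.
Proof.
move=> Xconn Yconn XY f_surj D_neq0 D_free e1 Xe.
have deg K L rhoY rhoX phi KY LX phiE : has_ext_degree phi #|I| :=
  function_field_degree KY LX phiE D_neq0 D_free e1 (@Xe K L rhoY rhoX phi KY LX phiE).
have [y0 Yy0 _] := D_neq0; have [x0 [Xx0 _]] := f_surj _ Yy0.
split=> [|d [K [L [rhoY [rhoX [phi [KY LX phiE deg_d]]]]]]]; last first.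
  have deg_I := deg _ _ _ _ _ KY LX phiE.
  apply/eqP; rewrite eqn_leq.
  by rewrite (has_ext_degree_le deg_d deg_I) (has_ext_degree_le deg_I deg_d).
have [L [rhoX LX]] := curve_connected_function_field (ex_intro _ _ Xx0) Xconn.
have [K [rhoY KY]] := curve_connected_function_field (ex_intro _ _ Yy0) Yconn.
have [phi phiE] := pullback_exists KY LX XY f_surj.
by exists K, L, rhoY, rhoX, phi; split=> //; apply: deg KY LX phiE.
Qed.

Lemma natC_neq0 k : k.+1%:R != 0 :> C.
Proof. by rewrite Num.Theory.pnatr_eq0. Qed.

Lemma opp_eq_self (a : C) : (a == - a) = (a == 0).
Proof.
by rewrite -addr_eq0 -mulr2n -mulr_natr mulf_eq0 (negPf (natC_neq0 1)) orbF.
Qed.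

(** Each of [u'] and [v'] is determined up to sign. Opposite signs force [u * v = 0], and then the
    sign of the vanishing entry can be changed freely. *)
Lemma sqr_pair_eq (u v u' v' : C) :
    u' ^+ 2 = u ^+ 2 -> u' * v' = u * v -> v' ^+ 2 = v ^+ 2 ->
  u' = u /\ v' = v \/ u' = - u /\ v' = - v.
Proof.
have cross (z w : C) : - (z * w) = z * w -> z = 0 \/ w = 0.
  move/eqP; rewrite eq_sym -addr_eq0 -mulr2n -mulr_natr !mulf_eq0.
  by rewrite (negPf (natC_neq0 1)) orbF => /orP [] /eqP; [left|right].
move=> /eqP; rewrite eqf_sqr => uu e /eqP; rewrite eqf_sqr; move: uu e.
move=> /orP [] /eqP -> e /orP [] /eqP ve; move: e; rewrite ve.
- by left.
- by rewrite mulrN => /cross [] ->; [right|left]; rewrite ?oppr0.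
- by rewrite mulNr => /cross [] ->; [left|right]; rewrite ?oppr0.
by right.
Qed.

Lemma sqr_surj (c : C) : exists a, a ^+ 2 = c.
Proof. by exists (sqrtc c); rewrite sqr_sqrtc. Qed.

Lemma meval_nth n (a : n.-tuple C) (i : 'I_n) : ('X_i).@[tnth a] = a`_i.
Proof. by rewrite mevalXU (tnth_nth 0). Qed.

Definition mevalR := (meval_nth, mevalD, mevalN, mevalM, rmorphXn, rmorph_nat, rmorph1).

Lemma FtildeE (a : 3.-tuple C) : polymap (Ftilde R) a =
  [tuple a`_0 ^+ 2 + a`_1 ^+ 2; a`_2 ^+ 2; a`_2 * (a`_0 ^+ 2 - a`_1 ^+ 2);
    (a`_0 ^+ 2 - a`_1 ^+ 2) ^+ 2].
Proof.
apply: eq_from_tnth => i; rewrite tnth_mktuple.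
case: i => [[|[|[|[|//]]]] lt_i4]; rewrite !(tnth_nth 0) /=.
all: by do 3 rewrite ?(mevalR) /=.
Qed.

Lemma g_2E (a : 4.-tuple C) : polymap (g_2 R) a =
  let u := a`_1 - 2 * a`_0 + 2 in
  let v := 2 * a`_3 - a`_0 ^+ 2 - 4 * a`_2 + 4 * a`_1 in
  [tuple a`_0 ^+ 2 + 4 * a`_1 - 4 * a`_2; u ^+ 2; u * v; v ^+ 2].
Proof.
apply: eq_from_tnth => i; rewrite tnth_mktuple.
case: i => [[|[|[|[|//]]]] lt_i4]; rewrite !(tnth_nth 0) /=.
all: by do 3 rewrite ?(mevalR) /=.
Qed.

Lemma V2P (n : nat) (h k : {mpoly C[n]}) (a : n.-tuple C) :
  V [:: h; k] a <-> h.@[tnth a] = 0 /\ k.@[tnth a] = 0.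
Proof.
split=> [Va|[ha ka] l]; first by split; apply: Va; rewrite !inE eqxx ?orbT.
by rewrite !inE => /orP [] /eqP ->.
Qed.

Lemma X_QP (a : 4.-tuple C) : X_Q R a <-> a`_2 ^+ 2 = a`_1 * a`_3.
Proof.
have -> : X_Q R a <-> a`_2 ^+ 2 - a`_1 * a`_3 = 0.
  by rewrite /X_Q V1P !mevalR.
by split=> [/eqP|->]; rewrite ?subrr // subr_eq0 => /eqP.
Qed.

Lemma L_1P (a : 4.-tuple C) : L_1 R a <-> [/\ a`_1 = 0, a`_2 = 0 & a`_3 = 0].
Proof.
split=> [La|[h1 h2 h3] l].
  have L h : h \in [:: 'X_(1 : 'I_4); 'X_(2 : 'I_4); 'X_(3 : 'I_4)] ->
    h.@[tnth a] = 0 := La h.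
  by split; [have := L 'X_1 | have := L 'X_2 | have := L 'X_3];
    rewrite meval_nth => -> //; rewrite !inE eqxx ?orbT.
by rewrite !inE => /or3P [] /eqP ->; rewrite meval_nth.
Qed.

Lemma S_PP (a : 4.-tuple C) :
  S_P R a <-> a`_0 ^+ 2 = a`_3 /\ a`_2 ^+ 2 = a`_1 * a`_3.
Proof.
have -> : S_P R a <-> a`_0 ^+ 2 - a`_3 = 0 /\ a`_1 * a`_3 - a`_2 ^+ 2 = 0.
  by rewrite /S_P V2P !mevalR.
split=> -[h1 h2]; last by rewrite h1 h2 !subrr.
by split; apply/eqP; rewrite -subr_eq0 ?h1 // -oppr_eq0 opprB h2.
Qed.

Lemma meval_A_h (a : 4.-tuple C) :
  (A_h R).@[tnth a] = discA a`_0 a`_1 a`_2 a`_3.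
Proof.
have -> : A_h R = discA 'X_0 'X_1 'X_2 'X_3 by [].
have := @rmorph_discA _ _ (meval (tnth a)) _ _ _ _ _ _ _ _ (meval_nth a 0)
  (meval_nth a 1) (meval_nth a 2) (meval_nth a 3).
exact.
Qed.

Lemma S_AP (a : 4.-tuple C) :
  S_A R a <-> discA a`_0 a`_1 a`_2 a`_3 = 0 /\ a`_2 ^+ 2 = a`_1 * a`_3.
Proof.
have -> : S_A R a <->
    discA a`_0 a`_1 a`_2 a`_3 = 0 /\ a`_1 * a`_3 - a`_2 ^+ 2 = 0.
  by rewrite /S_A V2P meval_A_h !mevalR.
split=> -[h1 h2]; split=> //; last by rewrite h2 subrr.
by apply/esym/eqP; rewrite -subr_eq0 h2.
Qed.

(** Let [u] be a square root of the coordinate q. If [u] is nonzero, [v] is r divided by [u];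
    otherwise r vanishes too and any square root of s serves. *)
Lemma X_Q_param (a : 4.-tuple C) : X_Q R a ->
  exists u v, [/\ u ^+ 2 = a`_1, u * v = a`_2 & v ^+ 2 = a`_3].
Proof.
move/X_QP => aE; have [u uE] := sqr_surj a`_1.
have [u0|u_neq0] := eqVneq u 0.
  have [v vE] := sqr_surj a`_3; exists u, v; split=> //.
  apply/esym/eqP; rewrite u0 mul0r -sqrf_eq0 aE -uE u0; apply/eqP; ring.
exists u, (a`_2 / u); split=> //; first by rewrite mulrC divfK.
by rewrite expr_div_n aE uE mulrAC divff ?mul1r // -uE sqrf_eq0.
Qed.

Lemma line_horner (c d t : C) : (c%:P + (d - c)%:P * 'X).[t] = c + (d - c) * t.
Proof. by rewrite hornerD hornerM !hornerC hornerX. Qed.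

Lemma affine_curve_connected n : curve_connected [set: n.-tuple C].
Proof.
move=> a b _ _; exists (fun i => (tnth a i)%:P + (tnth b i - tnth a i)%:P * 'X).
by split=> // i; rewrite line_horner; ring.
Qed.

Lemma tuple4_eta (a : 4.-tuple C) : a = [tuple a`_0; a`_1; a`_2; a`_3].
Proof. by case: a => [[|a0 [|a1 [|a2 [|a3 [|]]]]] ?] //; apply: val_inj. Qed.

Lemma tuple3_eta (a : 3.-tuple C) : a = [tuple a`_0; a`_1; a`_2].
Proof. by case: a => [[|a0 [|a1 [|a2 [|]]]] ?] //; apply: val_inj. Qed.

(** Lines in the space of parameters [(p, u, v)] are mapped into [X_Q] by [(p, u^2, u v, v^2)]. *)
Lemma X_Q_curve_connected : curve_connected (X_Q R).
Proof.
move=> a b /X_Q_param [u [v [a1 a2 a3]]] /X_Q_param [u' [v' [b1 b2 b3]]].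
pose l (c d : C) := c%:P + (d - c)%:P * 'X.
have lE c d t : (l c d).[t] = c + (d - c) * t := line_horner c d t.
pose g := [tuple l a`_0 b`_0; l u u' ^+ 2; l u u' * l v v'; l v v' ^+ 2].
have gE t : [tuple (tnth g i).[t] | i < 4] = [tuple a`_0 + (b`_0 - a`_0) * t;
    (u + (u' - u) * t) ^+ 2; (u + (u' - u) * t) * (v + (v' - v) * t);
    (v + (v' - v) * t) ^+ 2].
  apply: eq_from_tnth => i; rewrite tnth_mktuple.
  by case: i => [[|[|[|[|//]]]] lt_i4]; rewrite !(tnth_nth 0) /= ?horner_exp
    ?hornerM ?lE.
exists (tnth g); split=> [i|i|t]; last by rewrite gE; apply/X_QP => /=; ring.
  have := congr1 (fun t => tnth t i) (gE 0); rewrite /= tnth_mktuple => ->.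
  rewrite [in RHS](tuple4_eta a) -a1 -a2 -a3.
  by congr (tnth _ i); apply: val_inj => /=; congr [:: _; _; _; _]; ring.
have := congr1 (fun t => tnth t i) (gE 1); rewrite /= tnth_mktuple => ->.
rewrite [in RHS](tuple4_eta b) -b1 -b2 -b3.
by congr (tnth _ i); apply: val_inj => /=; congr [:: _; _; _; _]; ring.
Qed.

End Cover.

(** * The quotient map [Ftilde] *)

Section Ftilde.
Variable R : realType.
Local Notation C := R[i].

Definition point3 (a b z : C) : 3.-tuple C := [tuple a; b; z].

(** The images of [(a, b, z)] under the eight elements of the dihedral group: first the sign changes
    fixing [z], then those that also swap the first two coordinates and negate [z]. *)
Definition orbit (a b z : C) : seq (3.-tuple C) :=
  [:: point3 a b z; point3 (- a) b z; point3 a (- b) z; point3 (- a) (- b) z;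
      point3 b a (- z); point3 (- b) a (- z); point3 b (- a) (- z);
      point3 (- b) (- a) (- z)].

Lemma point3_eq a b z a' b' z' :
  (point3 a b z == point3 a' b' z') = [&& a == a', b == b' & z == z'].
Proof. by rewrite -val_eqE /= !eqseq_cons andbT. Qed.

Lemma Ftilde_point3 a b z : polymap (Ftilde R) (point3 a b z) =
  [tuple a ^+ 2 + b ^+ 2; z ^+ 2; z * (a ^+ 2 - b ^+ 2); (a ^+ 2 - b ^+ 2) ^+ 2].
Proof. by rewrite FtildeE. Qed.

(** The last three coordinates determine the pair [(z, x^2 - y^2)] up to a common sign. With
    [x^2 + y^2] known, one sign gives the squares of [a] and [b] in order, the other gives them
    swapped. *)
Lemma Ftilde_fiber a b z :
  fiber [set: 3.-tuple C] (Ftilde R) (polymap (Ftilde R) (point3 a b z)) =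
  [set` orbit a b z].
Proof.
apply/seteqP; split=> x /=; last first.
  rewrite !inE => xs; split=> //.
  move: xs => /orP [/eqP ->|/orP [/eqP ->|/orP [/eqP ->|/orP [/eqP ->|
    /orP [/eqP ->|/orP [/eqP ->|/orP [/eqP ->|/eqP ->]]]]]]];
    rewrite !Ftilde_point3; apply: val_inj => /=; congr [:: _; _; _; _]; ring.
move=> [_]; rewrite [x]tuple3_eta -[tuple _]/(point3 x`_0 x`_1 x`_2).
move: x`_0 x`_1 x`_2 => {x} x y t; rewrite !Ftilde_point3 => /(congr1 val) [].
move=> Pxy Qt Rt Sxy; rewrite !inE !point3_eq.
have two0 := natC_neq0 R 1.
have [[-> w_eq]|[-> w_eq]] := sqr_pair_eq Qt Rt Sxy.
- have : x ^+ 2 == a ^+ 2.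
    by apply/eqP/(mulfI two0); transitivity ((x ^+ 2 + y ^+ 2) + (x ^+ 2 - y ^+ 2));
      [|rewrite Pxy w_eq]; ring.
  have : y ^+ 2 == b ^+ 2.
    by apply/eqP/(mulfI two0); transitivity ((x ^+ 2 + y ^+ 2) - (x ^+ 2 - y ^+ 2));
      [|rewrite Pxy w_eq]; ring.
  by rewrite !eqf_sqr => /orP [] /eqP -> /orP [] /eqP ->; rewrite !eqxx ?orbT.
have : x ^+ 2 == b ^+ 2.
  by apply/eqP/(mulfI two0); transitivity ((x ^+ 2 + y ^+ 2) + (x ^+ 2 - y ^+ 2));
    [|rewrite Pxy w_eq]; ring.
have : y ^+ 2 == a ^+ 2.
  by apply/eqP/(mulfI two0); transitivity ((x ^+ 2 + y ^+ 2) - (x ^+ 2 - y ^+ 2));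
    [|rewrite Pxy w_eq]; ring.
by rewrite !eqf_sqr => /orP [] /eqP -> /orP [] /eqP ->; rewrite !eqxx ?orbT.
Qed.

Lemma Ftilde_surj y : X_Q R y -> exists a b z, polymap (Ftilde R) (point3 a b z) = y.
Proof.
move=> /X_Q_param [z [w [zE zwE wE]]].
have [a aE] := sqr_surj ((y`_0 + w) / 2); have [b bE] := sqr_surj ((y`_0 - w) / 2).
have two0 := natC_neq0 R 1.
have E : a ^+ 2 - b ^+ 2 = w by rewrite aE bE; field.
exists a, b, z; rewrite Ftilde_point3 E zE zwE wE [RHS]tuple4_eta.
by apply: val_inj; congr [:: _; _; _; _]; rewrite aE bE; field.
Qed.

(** Each half of the list is free of repetitions exactly when [a] and [b] are nonzero; in that case
    the halves meet only if [z = - z] and [a] is [b] or [- b]. *)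
Lemma uniq_orbit a b z :
  uniq (orbit a b z) = [&& a != 0, b != 0 & (z != 0) || (a ^+ 2 != b ^+ 2)].
Proof.
have oppE (c : C) : (- c == c) = (c == 0) by rewrite eq_sym opp_eq_self.
have [->|a0] := eqVneq a 0.
  by rewrite /orbit /= !inE !point3_eq !oppr0 !eqxx.
have [->|b0] := eqVneq b 0.
  by rewrite /orbit /= !inE !point3_eq !oppr0 !eqxx /= !orbT /= ?andbF.
rewrite eqf_sqr /orbit /= !inE !point3_eq !opp_eq_self !oppE !eqr_opp.
rewrite (negPf a0) (negPf b0).
have [->|z0] := eqVneq z 0.
  have baN : (b == - a) = (a == - b) by rewrite eq_sym eqr_oppLR.
  rewrite !eqxx !(eq_sym b a) !(eq_sym (- b) a) !eqr_oppLR !baN.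
  by case: (a == b); case: (a == - b).
by rewrite !andbF.
Qed.

Lemma sum_bool3 (V : nmodType) (F : bool * bool * bool -> V) :
  \sum_i F i =
    F (true, true, true) + F (true, true, false) +
    (F (true, false, true) + F (true, false, false)) +
    (F (false, true, true) + F (false, true, false) +
    (F (false, false, true) + F (false, false, false))).
Proof.
transitivity (\sum_i \sum_j \sum_k F (i, j, k)); last by rewrite !big_bool.
by rewrite !pair_bigA; apply: eq_bigr => [[[i j] k] _].
Qed.

Definition basis3 (i : bool * bool * bool) : {mpoly C[3]} :=
  'X_0 ^+ i.1.1 * 'X_1 ^+ i.1.2 * 'X_2 ^+ i.2.

Lemma meval_basis3 a b z i :
  (basis3 i).@[tnth (point3 a b z)] = a ^+ i.1.1 * b ^+ i.1.2 * z ^+ i.2.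
Proof. by rewrite /basis3 !mevalM !rmorphXn /= !meval_nth. Qed.

Lemma sign_vanish (A B x : C) :
  x != 0 -> A + B * x = 0 -> A + B * (- x) = 0 -> A = 0 /\ B = 0.
Proof.
move=> x0 e1 e2; have two0 := natC_neq0 R 1.
split; apply: (mulfI two0); rewrite mulr0.
  by transitivity ((A + B * x) + (A + B * (- x))); [ring | rewrite e1 e2 addr0].
apply: (mulIf x0); rewrite mul0r.
by transitivity ((A + B * x) - (A + B * (- x))); [ring | rewrite e1 e2 subr0].
Qed.

Lemma signs_vanish (A B D E x y : C) : x != 0 -> y != 0 ->
    A + B * x + D * y + E * x * y = 0 ->
    A + B * (- x) + D * y + E * (- x) * y = 0 ->
    A + B * x + D * (- y) + E * x * (- y) = 0 ->
    A + B * (- x) + D * (- y) + E * (- x) * (- y) = 0 ->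
  [/\ A = 0, B = 0, D = 0 & E = 0].
Proof.
move=> x0 y0 e1 e2 e3 e4.
have split_x y' : A + B * x + D * y' + E * x * y' = 0 ->
    A + B * (- x) + D * y' + E * (- x) * y' = 0 ->
    A + D * y' = 0 /\ B + E * y' = 0.
  move=> ep en; apply: (sign_vanish x0).
    by rewrite -[RHS]ep; ring.
  by rewrite -[RHS]en; ring.
have [AD BE] := split_x y e1 e2; have [AD' BE'] := split_x (- y) e3 e4.
by have [-> ->] := sign_vanish y0 AD AD'; have [-> ->] := sign_vanish y0 BE BE'.
Qed.

(** At the image of [(a, b, z)] the polynomial takes the value [4 a^2 b^2 z^2], so all three
    coordinates are nonzero, and the sign changes in the orbit separate the eight monomials. *)
Lemma Ftilde_generic_free (y : 4.-tuple C) (c : bool * bool * bool -> C) :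
    X_Q R y -> ('X_1 * ('X_0 ^+ 2 - 'X_3) : {mpoly C[4]}).@[tnth y] != 0 ->
    (forall x, fiber [set: 3.-tuple C] (Ftilde R) y x ->
      \sum_i c i * (basis3 i).@[tnth x] = 0) ->
  forall i, c i = 0.
Proof.
move=> /Ftilde_surj [a [b [z yE]]]; rewrite -yE Ftilde_fiber.
rewrite Ftilde_point3 !mevalR /= => Dy c0.
have z0 : z != 0.
  by apply: contra_neq Dy => ->; rewrite expr0n mul0r.
have a0 : a != 0.
  by apply: contra_neq Dy => ->; ring.
have b0 : b != 0.
  by apply: contra_neq Dy => ->; ring.
have eqn x y' t : point3 x y' t \in orbit a b z ->
    (c (false, false, false) + c (false, false, true) * t) +
    (c (true, false, false) + c (true, false, true) * t) * x +
    (c (false, true, false) + c (false, true, true) * t) * y' +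
    (c (true, true, false) + c (true, true, true) * t) * x * y' = 0.
  move=> xs; have := c0 _ xs.
  under eq_bigr => i _ do rewrite meval_basis3.
  by rewrite sum_bool3 /= => <-; ring.
(* Reduction modulo 8 keeps the index in range for every [k]. *)
have inorb k : nth (point3 a b z) (orbit a b z) (k %% 8) \in orbit a b z.
  by apply: mem_nth; rewrite ltn_mod.
have [A1 B1 D1 E1] := signs_vanish a0 b0 (eqn _ _ _ (inorb 0)) (eqn _ _ _ (inorb 1))
   (eqn _ _ _ (inorb 2)) (eqn _ _ _ (inorb 3)).
(* The second half of the orbit gives the same coefficients with [- z] in place of [z]. *)
have [A2 B2 D2 E2] := signs_vanish b0 a0 (eqn _ _ _ (inorb 4)) (eqn _ _ _ (inorb 5))
   (eqn _ _ _ (inorb 6)) (eqn _ _ _ (inorb 7)).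
have [? ?] := sign_vanish z0 A1 A2; have [? ?] := sign_vanish z0 B1 B2.
have [? ?] := sign_vanish z0 D1 D2; have [? ?] := sign_vanish z0 E1 E2.
by case=> [[[] []] []].
Qed.

Lemma Ftilde_span_stable (K L : fieldType) (rhoY : {rmorphism {mpoly C[4]} -> K})
    (rhoX : {rmorphism {mpoly C[3]} -> L}) (phi : {rmorphism K -> L}) :
    is_function_field (X_Q R) rhoY ->
    (forall h, phi (rhoY h) = rhoX (h \mPo Ftilde R)) ->
  forall j, span_stable phi (fun i => rhoX (basis3 i)) (rhoX 'X_j).
Proof.
move=> KY phiE.
(* A point of [X_Q] where the coordinate q is nonzero: it shows that q and the nonzero integers
   survive in [K]. *)
have XQ1 : X_Q R [tuple 0; 1; 0; 0] by apply/X_QP => /=; ring.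
have two0 : 2 != 0 :> K.
  rewrite -(rmorph_nat rhoY); apply: (function_field_neq0 KY XQ1).
  by rewrite rmorph_nat natC_neq0.
have q0 : rhoY 'X_1 != 0.
  by apply: (function_field_neq0 KY XQ1); rewrite meval_nth oner_eq0.
have pE : phi (rhoY 'X_0) = rhoX 'X_0 ^+ 2 + rhoX 'X_1 ^+ 2.
  by rewrite phiE comp_mpolyXU /= rmorphD !rmorphXn.
have qE : phi (rhoY 'X_1) = rhoX 'X_2 ^+ 2.
  by rewrite phiE comp_mpolyXU /= rmorphXn.
have rE : phi (rhoY 'X_2) = rhoX 'X_2 * (rhoX 'X_0 ^+ 2 - rhoX 'X_1 ^+ 2).
  by rewrite phiE comp_mpolyXU /= rmorphM rmorphB !rmorphXn.
have z0 : rhoX 'X_2 != 0.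
  by rewrite -sqrf_eq0 -qE fmorph_eq0.
have eE i j k : rhoX (basis3 (i, j, k)) =
    rhoX 'X_0 ^+ i * rhoX 'X_1 ^+ j * rhoX 'X_2 ^+ k.
  by rewrite /basis3 !rmorphM !rmorphXn.
have gen i j k : ext_span phi (fun i => rhoX (basis3 i))
    (rhoX 'X_0 ^+ nat_of_bool i * rhoX 'X_1 ^+ nat_of_bool j *
      rhoX 'X_2 ^+ nat_of_bool k).
  by rewrite -eE; apply: (ext_span_gen phi (fun i => rhoX (basis3 i))).
have z_stable : span_stable phi (fun i => rhoX (basis3 i)) (rhoX 'X_2).
  apply: span_stable_gen => -[[i j] [|]]; rewrite eE.
    have -> : rhoX 'X_2 * (rhoX 'X_0 ^+ i * rhoX 'X_1 ^+ j * rhoX 'X_2 ^+ true) =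
        phi (rhoY 'X_1) * (rhoX 'X_0 ^+ i * rhoX 'X_1 ^+ j * rhoX 'X_2 ^+ false).
      by rewrite qE expr0 expr1; ring.
    exact/ext_spanZ/gen.
  have -> : rhoX 'X_2 * (rhoX 'X_0 ^+ i * rhoX 'X_1 ^+ j * rhoX 'X_2 ^+ false) =
     (rhoX 'X_0 ^+ i * rhoX 'X_1 ^+ j * rhoX 'X_2 ^+ true).
    by rewrite expr0 expr1; ring.
  exact: gen.
have phi20 : phi 2 != 0 by rewrite fmorph_eq0.
have x2_stable : span_stable phi (fun i => rhoX (basis3 i)) (rhoX 'X_0 ^+ 2).
  (* With q equal to [z^2] and r to [z (x^2 - y^2)], the difference [x^2 - y^2] is [(r / q) z],
     while the sum [x^2 + y^2] is p. *)
  have -> : rhoX 'X_0 ^+ 2 = phi (rhoY 'X_0 / 2) +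
      phi (rhoY 'X_2 / (2 * rhoY 'X_1)) * rhoX 'X_2.
    rewrite !fmorph_div rmorphM pE qE rE; move: phi20; rewrite rmorph_nat => ?.
    by field; apply/andP.
  by apply: span_stableD; [|apply: span_stableM => //]; apply: span_stable_phi.
have y2_stable : span_stable phi (fun i => rhoX (basis3 i)) (rhoX 'X_1 ^+ 2).
  have -> : rhoX 'X_1 ^+ 2 = phi (rhoY 'X_0) - rhoX 'X_0 ^+ 2 by rewrite pE addrC addKr.
  by apply: span_stableD; [|apply: span_stableN => //]; apply: span_stable_phi.
have x_stable : span_stable phi (fun i => rhoX (basis3 i)) (rhoX 'X_0).
  apply: span_stable_gen => -[[[|] j] k]; rewrite eE.
    have -> : rhoX 'X_0 * (rhoX 'X_0 ^+ true * rhoX 'X_1 ^+ j * rhoX 'X_2 ^+ k) =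
        rhoX 'X_0 ^+ 2 * (rhoX 'X_0 ^+ false * rhoX 'X_1 ^+ j * rhoX 'X_2 ^+ k).
      by rewrite expr0 expr1; ring.
    exact/x2_stable/gen.
  rewrite expr0 mul1r mulrA; exact: (gen true).
have y_stable : span_stable phi (fun i => rhoX (basis3 i)) (rhoX 'X_1).
  apply: span_stable_gen => -[[i [|]] k]; rewrite eE.
    have -> : rhoX 'X_1 * (rhoX 'X_0 ^+ i * rhoX 'X_1 ^+ true * rhoX 'X_2 ^+ k) =
        rhoX 'X_1 ^+ 2 * (rhoX 'X_0 ^+ i * rhoX 'X_1 ^+ false * rhoX 'X_2 ^+ k).
      by rewrite expr0 expr1; ring.
    exact/y2_stable/gen.
  by rewrite expr0 mulr1 mulrA [rhoX 'X_1 * _]mulrC; exact: (gen i true).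
case=> [[|[|[|//]]] lt_i3].
- by rewrite (_ : Ordinal lt_i3 = 0) //; apply: val_inj.
- by rewrite (_ : Ordinal lt_i3 = 1) //; apply: val_inj.
- by rewrite (_ : Ordinal lt_i3 = 2) //; apply: val_inj.
Qed.

Lemma Ftilde_degree : has_degree [set: 3.-tuple C] (X_Q R) (Ftilde R) 8%N /\
  forall d, has_degree [set: 3.-tuple C] (X_Q R) (Ftilde R) d -> d = 8%N.
Proof.
have <- : #|{: bool * bool * bool}| = 8%N by rewrite !card_prod !card_bool.
apply: (@has_degree_basis R 3 4 _ _ _ _ basis3 (false, false, false)
  ('X_1 * ('X_0 ^+ 2 - 'X_3))).
- exact: affine_curve_connected.
- exact: X_Q_curve_connected.
- by move=> x _; apply: Ftilde_X_Q.
- by move=> y /Ftilde_surj [a [b [z <-]]]; exists (point3 a b z).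
- exists [tuple 1; 1; 0; 0]; first by apply/X_QP => /=; ring.
  by rewrite !mevalR /= subr0 ?expr1n ?mulr1 ?mul1r oner_eq0.
- by move=> y Yy Dy c; apply: Ftilde_generic_free.
- by rewrite /basis3 !expr0 !mulr1.
- by move=> K L rhoY rhoX phi KY _ phiE; exact: (Ftilde_span_stable KY phiE).
Qed.

Lemma Ftilde_branch_locus :
  branch_locus [set: 3.-tuple C] (X_Q R) (Ftilde R) = L_1 R `|` S_P R.
Proof.
have [deg8 deg_uniq] := Ftilde_degree.
apply: branch_locus_eq => y.
  by move=> [/L_1P [h1 h2 h3]|/S_PP [_ h]]; apply/X_QP; rewrite // h1 h2 h3; ring.
move=> Yy; have [a [b [z yE]]] := Ftilde_surj Yy.
have fE : fiber [set: 3.-tuple C] (Ftilde R) y = [set` orbit a b z].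
  by rewrite -yE Ftilde_fiber.
rewrite (branch_locusP deg8 deg_uniq Yy fE erefl) uniq_orbit.
rewrite /setU /= L_1P S_PP -yE Ftilde_point3 /=; split.
  rewrite !negb_and negb_or !negbK => /or3P [/eqP ->|/eqP ->|/andP [/eqP -> /eqP ->]].
  - by right; split; ring.
  - by right; split; ring.
  - by left; split; ring.
case=> [[z2 _ w2]|[Pw _]]; apply/negP => /and3P [a0 b0].
  have /eqP -> : z == 0 by rewrite -sqrf_eq0 z2.
  by rewrite eqxx -subr_eq0 -sqrf_eq0 w2 eqxx.
(* This product is [(a^2 + b^2)^2 - (a^2 - b^2)^2], the value of [p^2 - s]. *)
move=> _; have : 4 * (a ^+ 2 * b ^+ 2) = 0.
  apply/eqP; rewrite -(subrr ((a ^+ 2 - b ^+ 2) ^+ 2)) -{1}Pw; apply/eqP; ring.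
move/eqP; rewrite mulf_eq0 (negPf (natC_neq0 R 3)) /= mulf_eq0 !sqrf_eq0.
by rewrite (negPf a0) (negPf b0).
Qed.

End Ftilde.

(** * The map [g_2] *)

(** The discriminant of the monic quartic [t^4 + c3 t^3 + c2 t^2 + c1 t + c0]. *)
Definition quartic_disc (F : pzRingType) (c3 c2 c1 c0 : F) : F :=
  256 * c0 ^+ 3 - 192 * c3 * c1 * c0 ^+ 2 - 128 * c2 ^+ 2 * c0 ^+ 2
  + 144 * c2 * c1 ^+ 2 * c0 - 27 * c1 ^+ 4 + 144 * c3 ^+ 2 * c2 * c0 ^+ 2
  - 6 * c3 ^+ 2 * c1 ^+ 2 * c0 - 80 * c3 * c2 ^+ 2 * c1 * c0
  + 18 * c3 * c2 * c1 ^+ 3 + 16 * c2 ^+ 4 * c0 - 4 * c2 ^+ 3 * c1 ^+ 2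
  - 27 * c3 ^+ 4 * c0 ^+ 2 + 18 * c3 ^+ 3 * c2 * c1 * c0
  - 4 * c3 ^+ 3 * c1 ^+ 3 - 4 * c3 ^+ 2 * c2 ^+ 3 * c0
  + c3 ^+ 2 * c2 ^+ 2 * c1 ^+ 2.

Lemma quartic_disc_roots (F : comPzRingType) (a b c d : F) :
  quartic_disc (- (a + b + c + d))
    (a * b + a * c + a * d + b * c + b * d + c * d)
    (- (a * b * c + a * b * d + a * c * d + b * c * d)) (a * b * c * d) =
  ((a - b) * (a - c) * (a - d) * (b - c) * (b - d) * (c - d)) ^+ 2.
Proof. by rewrite /quartic_disc; ring. Qed.

(** * The quartic that governs the fibres of [g_2] *)

Section FiberQuartic.
Variable F : comPzRingType.
Implicit Types P u v t : F.

Definition fiber_c2 P u : F := 64 + 2 * (4 * u - 8 - P) - 16 * (u - 2).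
Definition fiber_c1 P u v : F := 16 * (4 * u - 8 - P) - 16 * (v - P).
Definition fiber_c0 P u v : F := (4 * u - 8 - P) ^+ 2 - 8 * (u - 2) * (v - P).

Definition fiber_quartic P u v t : F :=
  t ^+ 4 - 16 * t ^+ 3 + fiber_c2 P u * t ^+ 2 + fiber_c1 P u v * t + fiber_c0 P u v.

(** The right-hand side is [16 (r^2 - q s)] after q, r and s are expressed through [P], [u], [v] and
    [t]. *)
Lemma fiber_quarticE P u v t : fiber_quartic P u v t =
  (t ^+ 2 + 8 * t + 4 * u - 8 - P) ^+ 2 - 8 * (u + 2 * t - 2) * (2 * t ^+ 2 + v - P).
Proof.
rewrite /fiber_quartic /fiber_c2 /fiber_c1 /fiber_c0; ring.
Qed.

Lemma fiber_quartic_disc P u v :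
  quartic_disc (-16) (fiber_c2 P u) (fiber_c1 P u v) (fiber_c0 P u v) =
  128 ^+ 2 * (P + v) ^+ 2 * discA P (u ^+ 2) (u * v) (v ^+ 2).
Proof. rewrite /quartic_disc /fiber_c2 /fiber_c1 /fiber_c0 /discA; ring. Qed.

End FiberQuartic.

(** The difference of the two sides is a polynomial of degree at most 3 that vanishes everywhere, so
    its coefficients are zero. *)
Lemma quartic_vieta (F : numFieldType) (c3 c2 c1 c0 a b c d : F) :
    (forall t, t ^+ 4 + c3 * t ^+ 3 + c2 * t ^+ 2 + c1 * t + c0 =
      (t - a) * (t - b) * (t - c) * (t - d)) ->
  [/\ c3 = - (a + b + c + d), c2 = a * b + a * c + a * d + b * c + b * d + c * d,
    c1 = - (a * b * c + a * b * d + a * c * d + b * c * d) & c0 = a * b * c * d].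
Proof.
move=> cE; pose p := Poly [:: c0 - a * b * c * d;
  c1 + (a * b * c + a * b * d + a * c * d + b * c * d);
  c2 - (a * b + a * c + a * d + b * c + b * d + c * d); c3 + (a + b + c + d)].
have p0 : p = 0.
  apply: poly_vanish => t; rewrite horner_Poly /=.
  rewrite -[RHS](subrr ((t - a) * (t - b) * (t - c) * (t - d))).
  by rewrite -{1}cE; ring.
have coef k : p`_k = 0 by rewrite p0 coef0.
have := coef 0%N; have := coef 1%N; have := coef 2%N; have := coef 3%N.
rewrite /p !coef_Poly /= => h3 h2 h1 h0.
by split; apply/eqP; rewrite -subr_eq0 ?opprK ?h0 ?h1 ?h2 ?h3.
Qed.

(** * Fibres, degree and branch points of [g_2] *)

Section G2.
Variable R : realType.
Local Notation C := R[i].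

(** The quartic splits over the complex numbers. Its discriminant is the square of the product of
    the root differences, and the constant [128 ^+ 2] does not affect its vanishing. *)
Lemma fiber_quartic_roots (P u v : C) : exists rs : seq C,
  [/\ size rs = 4%N, forall t, (t \in rs) = (fiber_quartic P u v t == 0) &
    uniq rs = ((P + v) ^+ 2 * discA P (u ^+ 2) (u * v) (v ^+ 2) != 0)].
Proof.
pose p := Poly [:: fiber_c0 P u v; fiber_c1 P u v; fiber_c2 P u; -16; 1].
have pE : polyseq p = [:: fiber_c0 P u v; fiber_c1 P u v; fiber_c2 P u; -16; 1].
  by rewrite (@PolyK _ 0) //= oner_eq0.
have p_lead : lead_coef p = 1 by rewrite lead_coefE pE.
have pt t : p.[t] = fiber_quartic P u v t.
  rewrite horner_Poly /= /fiber_quartic; ring.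
have [rs] := closed_field_poly_normal p; rewrite p_lead scale1r => prs.
have rs4 : size rs = 4%N.
  by apply/eqP; rewrite -eqSS -(size_prod_XsubC rs id) -prs pE.
exists rs; split=> // [t|]; first by rewrite -root_prod_XsubC -prs rootE pt.
case: rs prs rs4 {p_lead pE} => [|a [|b [|c [|d [|]]]]] // prs _.
have [e3 e2 e1 e0] : [/\ -16 = - (a + b + c + d),
    fiber_c2 P u = a * b + a * c + a * d + b * c + b * d + c * d,
    fiber_c1 P u v = - (a * b * c + a * b * d + a * c * d + b * c * d) &
    fiber_c0 P u v = a * b * c * d].
  apply: quartic_vieta => t; have := pt t; rewrite /fiber_quartic mulNr => <-.
  by rewrite prs !big_cons big_nil /= !hornerE /=; ring.
have := fiber_quartic_disc P u v; rewrite e3 e2 e1 e0 quartic_disc_roots.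
rewrite -[RHS]mulrA => /(congr1 (fun x => x != 0)).
have n128 : 128 ^+ 2 != 0 :> C by rewrite expf_neq0 ?(natC_neq0 R 127).
rewrite [X in _ = ~~ X]mulf_eq0 (negPf n128) /=.
move=> <-; rewrite sqrf_eq0 !mulf_eq0 !subr_eq0 /= !inE.
by rewrite !negb_or !andbT -!andbA.
Qed.

(** Inverse of the change of coordinates taking [(p, q, r, s)] to the three expressions [P], [u],
    [v] from which [g_2] is composed, together with [t = p]. *)
Definition point4 (P u v t : C) : 4.-tuple C :=
  [tuple t; u + 2 * t - 2; (t ^+ 2 + 4 * (u + 2 * t - 2) - P) / 4;
    (v + 2 * t ^+ 2 - P) / 2].

Lemma point4_coord P u v t : let a := point4 P u v t in
  [/\ a`_0 ^+ 2 + 4 * a`_1 - 4 * a`_2 = P, a`_1 - 2 * a`_0 + 2 = u &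
    2 * a`_3 - a`_0 ^+ 2 - 4 * a`_2 + 4 * a`_1 = v].
Proof.
have [n2 n4] := (natC_neq0 R 1, natC_neq0 R 3).
by split=> /=; field.
Qed.

Lemma point4_X_Q P u v t : X_Q R (point4 P u v t) <-> fiber_quartic P u v t = 0.
Proof.
have [n2 n4] := (natC_neq0 R 1, natC_neq0 R 3).
have E : 16 * ((point4 P u v t)`_2 ^+ 2 - (point4 P u v t)`_1 * (point4 P u v t)`_3)
    = fiber_quartic P u v t.
  by rewrite fiber_quarticE /=; field.
rewrite X_QP -E; split=> [->|/eqP]; first by rewrite subrr mulr0.
by rewrite mulf_eq0 (negPf (natC_neq0 R 15)) subr_eq0 => /eqP.
Qed.

Lemma point4_surj (a : 4.-tuple C) : exists P u v t, a = point4 P u v t.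
Proof.
exists (a`_0 ^+ 2 + 4 * a`_1 - 4 * a`_2), (a`_1 - 2 * a`_0 + 2),
  (2 * a`_3 - a`_0 ^+ 2 - 4 * a`_2 + 4 * a`_1), a`_0.
have [n2 n4] := (natC_neq0 R 1, natC_neq0 R 3).
rewrite [LHS]tuple4_eta; apply: val_inj => /=.
by congr [:: _; _; _; _]; field.
Qed.

Lemma g_2_point4 P u v t :
  polymap (g_2 R) (point4 P u v t) = [tuple P; u ^+ 2; u * v; v ^+ 2].
Proof. by rewrite g_2E; have [-> -> ->] := point4_coord P u v t. Qed.

Lemma g_2_fiber P u v rs rs' :
    (forall t, (t \in rs) = (fiber_quartic P u v t == 0)) ->
    (forall t, (t \in rs') = (fiber_quartic P (- u) (- v) t == 0)) ->
  fiber (X_Q R) (g_2 R) [tuple P; u ^+ 2; u * v; v ^+ 2] =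
  [set` map (point4 P u v) rs ++ map (point4 P (- u) (- v)) rs'].
Proof.
move=> rsP rsP'; apply/seteqP; split=> x /=; rewrite mem_cat.
  have [P' [u' [v' [t ->]]]] := point4_surj x.
  move=> [/point4_X_Q q0]; rewrite g_2_point4 => /(congr1 val) [PE uE uvE vE].
  move: q0; rewrite {}PE; have [[-> ->]|[-> ->]] := sqr_pair_eq uE uvE vE.
    by move=> q0; rewrite map_f // rsP q0.
  by move=> q0; rewrite [X in _ || X]map_f ?orbT // rsP' q0.
case/orP=> /mapP [t tP ->]; rewrite /fiber /= g_2_point4; split.
- by apply/point4_X_Q/eqP; rewrite -rsP.
- by [].
- by apply/point4_X_Q/eqP; rewrite -rsP'.
by apply: val_inj => /=; congr [:: _; _; _; _]; ring.
Qed.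

Lemma discA_opp (P u v : C) :
  discA P ((- u) ^+ 2) (- u * - v) ((- v) ^+ 2) = discA P (u ^+ 2) (u * v) (v ^+ 2).
Proof. by rewrite !sqrrN mulrNN. Qed.

Lemma point4_inj P u v : injective (point4 P u v).
Proof. by move=> t t' /(congr1 val) []. Qed.

(** The quartics for [(u, v)] and [(- u, - v)] contribute four points each, and their discriminants
    the factors [P + v] and [P - v] besides the common [discA]. A point determines its [u] and [v],
    so the halves can only meet when both are zero. *)
Lemma g_2_fiber_seq (P u v : C) : exists s : seq (4.-tuple C),
  [/\ fiber (X_Q R) (g_2 R) [tuple P; u ^+ 2; u * v; v ^+ 2] = [set` s],
    size s = 8%N &
    uniq s = [&& (u != 0) || (v != 0), P ^+ 2 != v ^+ 2 &
      discA P (u ^+ 2) (u * v) (v ^+ 2) != 0]].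
Proof.
have [rs [rs4 rsP rsU]] := fiber_quartic_roots P u v.
have [rs' [rs4' rsP' rsU']] := fiber_quartic_roots P (- u) (- v).
exists (map (point4 P u v) rs ++ map (point4 P (- u) (- v)) rs'); split.
- exact: g_2_fiber.
- by rewrite size_cat !size_map rs4 rs4'.
rewrite cat_uniq !(map_inj_uniq (@point4_inj _ _ _)) rsU rsU' discA_opp.
have sqmul (x d : C) : (x ^+ 2 * d != 0) = (x != 0) && (d != 0).
  by rewrite mulf_eq0 sqrf_eq0 negb_or.
have sqE : (P ^+ 2 != v ^+ 2) = (P - v != 0) && (P + v != 0).
  by rewrite eqf_sqr negb_or subr_eq0 addr_eq0.
move: (discA _ _ _ _) => d; rewrite !sqmul sqE.
have disjoint_halves : (u != 0) || (v != 0) ->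
    ~~ has (mem (map (point4 P u v) rs)) (map (point4 P (- u) (- v)) rs').
  move=> uv0; apply/hasPn => x /mapP [t _ ->]; apply/mapP => -[t' _].
  have [_ uE vE] := point4_coord P (- u) (- v) t.
  have [_ uE' vE'] := point4_coord P u v t'.
  move=> e; move: uE vE uv0; rewrite e uE' vE' => /eqP; rewrite opp_eq_self => /eqP ->.
  by move=> /eqP; rewrite opp_eq_self => /eqP ->; rewrite eqxx.
have [uv0|] := boolP ((u != 0) || (v != 0)).
  by rewrite disjoint_halves //=; case: (d == 0); case: (P + v != 0);
    case: (P - v != 0).
rewrite negb_or !negbK => /andP [/eqP u0 /eqP v0] /=.
(* For [u = v = 0] the two quartics coincide, so any root gives a repeated point. *)
have rs_rs' : rs' =i rs by move=> t; rewrite rsP rsP' u0 v0 !oppr0.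
case: rs rs4 rs_rs' {rsP rsU disjoint_halves} => // t rs _ rs_rs'.
rewrite [has _ _](_ : _ = true) ?andbF //; apply/hasP.
exists (point4 P u v t); last by rewrite inE eqxx.
by rewrite u0 v0 oppr0 map_f // rs_rs' inE eqxx.
Qed.

(** The extension is a tower: the second factor [U] has its square in the base field, and p is a
    root of [fiber_quartic], of degree 4, over the field obtained by adjoining [U]. *)
Definition basis4 (i : 'I_4 * bool) : {mpoly C[4]} :=
  'X_0 ^+ i.1 * ('X_1 - 2 * 'X_0 + 2) ^+ i.2.

Lemma meval_basis4 P u v t i :
  (basis4 i).@[tnth (point4 P u v t)] = t ^+ i.1 * u ^+ i.2.
Proof.
rewrite /basis4; have [_ uE _] := point4_coord P u v t.
by rewrite mevalM !rmorphXn /= meval_nth mevalD mevalB mevalM !meval_nth !rmorph_nat uE.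
Qed.

Lemma uniq_roots_coef0 (F : idomainType) n (c : 'I_n -> F) (rs : seq F) :
    uniq rs -> size rs = n -> (forall t, t \in rs -> \sum_i c i * t ^+ i = 0) ->
  forall i, c i = 0.
Proof.
(* [insub] turns a natural number below [n] back into an ordinal; the default 0 is not met below
   [n]. *)
move=> rs_uniq rs_n c0 i; pose p := \poly_(k < n) if insub k is Some j then c j else 0.
have cE j : (if insub (val j) is Some k then c k else 0) = c j by rewrite valK.
suff p0 : p = 0.
  have := coef_poly n (fun k => if insub k is Some j then c j else 0) i.
  by rewrite -/p p0 coef0 ltn_ord cE.
apply/eqP; apply/negPn/negP => p_neq0.
have := max_poly_roots p_neq0 _ rs_uniq; rewrite rs_n ltnNge size_poly.
case/(_ _)/negP => //; apply/allP => t /c0 t0; rewrite /root horner_poly.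
by apply/eqP; rewrite -[RHS]t0; apply: eq_bigr => j _; rewrite cE.
Qed.

(** On each half of the fibre the relation is a polynomial in [t] of degree below 4 with four
    distinct roots. Hence [c (i, false) + c (i, true) * u] vanishes for both signs of [u], and [u]
    is nonzero. *)
Lemma g_2_generic_free (y : 4.-tuple C) (c : 'I_4 * bool -> C) :
    X_Q R y -> ('X_1 * ('X_0 ^+ 2 - 'X_3) * A_h R : {mpoly C[4]}).@[tnth y] != 0 ->
    (forall x, fiber (X_Q R) (g_2 R) y x ->
      \sum_i c i * (basis4 i).@[tnth x] = 0) ->
  forall i, c i = 0.
Proof.
move=> /X_Q_param [u [v [uE uvE vE]]].
have -> : y = [tuple y`_0; u ^+ 2; u * v; v ^+ 2] by rewrite uE uvE vE -tuple4_eta.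
move: y`_0 => P; rewrite !mevalM meval_A_h mevalB rmorphXn /= !meval_nth /=.
rewrite mulf_eq0 negb_or => /andP [Dy A0].
have u0 : u != 0 by apply: contra_neq Dy => ->; rewrite expr0n mul0r.
have Pv : P + v != 0.
  by apply: contra_neq Dy => /eqP; rewrite addr_eq0 => /eqP ->; ring.
have Pv' : P - v != 0.
  by apply: contra_neq Dy => /eqP; rewrite subr_eq0 => /eqP ->; ring.
have [rs [rs4 rsP rsU]] := fiber_quartic_roots P u v.
have [rs' [rs4' rsP' rsU']] := fiber_quartic_roots P (- u) (- v).
rewrite (g_2_fiber rsP rsP') => c0.
have {}rsU : uniq rs by rewrite rsU mulf_neq0 // expf_neq0.
have {}rsU' : uniq rs' by rewrite rsU' discA_opp mulf_neq0 // expf_neq0.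
have sumE u' v' t : \sum_i c i * (basis4 i).@[tnth (point4 P u' v' t)] =
    \sum_(i < 4) (c (i, false) + c (i, true) * u') * t ^+ i.
  transitivity (\sum_(i < 4) \sum_(j : bool) c (i, j) * (t ^+ i * u' ^+ j)).
    by rewrite pair_bigA; apply: eq_bigr => -[i j] _; rewrite meval_basis4.
  by apply: eq_bigr => i _; rewrite big_bool /= ?expr0 ?expr1; ring.
have plus0 t : t \in rs -> \sum_(i < 4) (c (i, false) + c (i, true) * u) * t ^+ i = 0.
  by move=> tr; rewrite -(sumE _ v); apply: c0 => /=; rewrite mem_cat map_f.
have minus0 t :
    t \in rs' -> \sum_(i < 4) (c (i, false) + c (i, true) * (- u)) * t ^+ i = 0.
  move=> tr; rewrite -(sumE _ (- v)); apply: c0 => /=.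
  by rewrite mem_cat [X in _ || X]map_f ?orbT.
move=> [i j]; have [] := sign_vanish u0 (uniq_roots_coef0 rsU rs4 plus0 i)
  (uniq_roots_coef0 rsU' rs4' minus0 i).
by case: j.
Qed.

Lemma g_2_span_stable (K L : fieldType) (rhoY : {rmorphism {mpoly C[4]} -> K})
    (rhoX : {rmorphism {mpoly C[4]} -> L}) (phi : {rmorphism K -> L}) :
    is_function_field (X_Q R) rhoY -> is_function_field (X_Q R) rhoX ->
    (forall h, phi (rhoY h) = rhoX (h \mPo g_2 R)) ->
  forall j, span_stable phi (fun i => rhoX (basis4 i)) (rhoX 'X_j).
Proof.
move=> KY LX phiE.
have XQ1 : X_Q R [tuple 0; 1; 0; 0] by apply/X_QP => /=; ring.
have natK k : k.+1%:R != 0 :> K.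
  rewrite -(rmorph_nat rhoY); apply: (function_field_neq0 KY XQ1).
  by rewrite rmorph_nat natC_neq0.
have natL k : k.+1%:R != 0 :> L.
  by rewrite -(rmorph_nat phi) fmorph_eq0.
have q0 : rhoY 'X_1 != 0.
  by apply: (function_field_neq0 KY XQ1); rewrite meval_nth oner_eq0.
set p := rhoX 'X_0; set q := rhoX 'X_1; set r := rhoX 'X_2; set s := rhoX 'X_3.
pose U := q - 2 * p + 2; pose W := 2 * s - p ^+ 2 - 4 * r + 4 * q.
have rsq : r ^+ 2 = q * s.
  apply/eqP; rewrite -subr_eq0 -rmorphXn -rmorphM -rmorphB; apply/eqP/LX.1.
  by move=> x /V1P.
have UE : rhoX ('X_1 - 2 * 'X_0 + 2) = U.
  by rewrite rmorphD rmorphB rmorphM !rmorph_nat.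
have WE : rhoX (2 * 'X_3 - 'X_0 ^+ 2 - 4 * 'X_2 + 4 * 'X_1) = W.
  by rewrite rmorphD !rmorphB rmorphXn !rmorphM !rmorph_nat.
have PE : phi (rhoY 'X_0) = p ^+ 2 + 4 * q - 4 * r.
  by rewrite phiE comp_mpolyXU /= rmorphB rmorphD rmorphXn !rmorphM !rmorph_nat.
have QE : phi (rhoY 'X_1) = U ^+ 2.
  by rewrite phiE comp_mpolyXU /= rmorphXn UE.
have RE : phi (rhoY 'X_2) = U * W.
  by rewrite phiE comp_mpolyXU /= rmorphM UE WE.
have U0 : U != 0 by rewrite -sqrf_eq0 -QE fmorph_eq0.
(* The ratio [W / U] equals [U W / U^2], which comes from the base field; adjoining [U] therefore
   gives [W] as well. *)
have WU : W = phi (rhoY 'X_2 / rhoY 'X_1) * U.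
  by rewrite fmorph_div QE RE; field.
have eE i j : rhoX (basis4 (i, j)) = p ^+ i * U ^+ j.
  by rewrite /basis4 rmorphM !rmorphXn UE.
pose stable := span_stable phi (fun i => rhoX (basis4 i)).
have gen (i : 'I_4) (j : bool) :
    ext_span phi (fun i => rhoX (basis4 i)) (p ^+ i * U ^+ j).
  by rewrite -eE; apply: (ext_span_gen phi (fun i => rhoX (basis4 i))).
have phiS a : stable (phi a) by apply: span_stable_phi.
have U_stable : stable U.
  apply: span_stable_gen => -[i [|]]; rewrite eE.
    have -> : U * (p ^+ i * U ^+ true) = phi (rhoY 'X_1) * (p ^+ i * U ^+ false).
      by rewrite QE expr0 expr1; ring.
    exact/ext_spanZ/gen.
  by rewrite expr0 mulr1 mulrC; apply: (gen i true).
have W_stable : stable W by rewrite WU; apply: span_stableM (phiS _) U_stable.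
have natS k : stable k%:R by rewrite -(rmorph_nat phi); apply: phiS.
pose P := phi (rhoY 'X_0).
(* The equation of [X_Q] in the new coordinates expresses [p ^+ 4] through lower powers, with
   coefficients in the base field and [U], [W]. *)
have p4 : p ^+ 4 =
    16 * p ^+ 3 - fiber_c2 P U * p ^+ 2 - fiber_c1 P U W * p - fiber_c0 P U W.
  apply/eqP; rewrite -subr_eq0; apply/eqP.
  transitivity (16 * (r ^+ 2 - q * s)); last by rewrite rsq subrr mulr0.
  transitivity (fiber_quartic P U W p); first by rewrite /fiber_quartic; ring.
  by rewrite fiber_quarticE /P PE /U /W; ring.
have c2S : stable (fiber_c2 P U).
  rewrite /fiber_c2; do ?[exact: natS | exact: phiS | exact: U_stable
    | apply: span_stableD | apply: span_stableM | apply: span_stableN].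
have c1S : stable (fiber_c1 P U W).
  rewrite /fiber_c1; do ?[exact: natS | exact: phiS | exact: U_stable | exact: W_stable
    | apply: span_stableD | apply: span_stableM | apply: span_stableN].
have c0S : stable (fiber_c0 P U W).
  rewrite /fiber_c0; do ?[exact: natS | exact: phiS | exact: U_stable | exact: W_stable
    | apply: span_stableD | apply: span_stableX | apply: span_stableM
    | apply: span_stableN].
have p_stable : stable p.
  apply: span_stable_gen => -[[i lt_i4] j]; rewrite eE /= mulrA -exprS.
  (* For [i < 3] the product with p is again a basis element; only [i = 3] requires [p4]. *)
  move: lt_i4; rewrite ltnS leq_eqVlt => /predU1P [->|lt_i3]; last first.
    exact: (gen (Ordinal (lt_i3 : (i.+1 < 4)%N))).
  have term k (lt_k4 : (k < 4)%N) a : stable a ->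
      ext_span phi (fun i => rhoX (basis4 i)) (a * (p ^+ k * U ^+ j)).
    by apply; apply: (gen (Ordinal lt_k4)).
  have -> : p ^+ 4 * U ^+ j = 16 * (p ^+ 3 * U ^+ j) +
      - fiber_c2 P U * (p ^+ 2 * U ^+ j) + - fiber_c1 P U W * (p ^+ 1 * U ^+ j) +
      - fiber_c0 P U W * (p ^+ 0 * U ^+ j).
    by rewrite p4; move: (U ^+ j) => Uj; ring.
  do 3?apply: ext_spanD; apply: term => //; exact: span_stableN.
(* The remaining coordinates are recovered from p, [U] and [W] by the formulas of [point4]. *)
have q_stable : stable q.
  have -> : q = U + 2 * p - 2 by rewrite /U; ring.
  by do ?[exact: natS | exact: p_stable | exact: U_stable | apply: span_stableD
    | apply: span_stableM | apply: span_stableN].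
have r_stable : stable r.
  have -> : r = phi 4^-1 * (p ^+ 2 + 4 * q - P).
    by rewrite fmorphV rmorph_nat /P PE; field; apply: natL 3.
  by do ?[exact: natS | exact: phiS | exact: p_stable | exact: q_stable
    | apply: span_stableX | apply: span_stableD | apply: span_stableM
    | apply: span_stableN].
have s_stable : stable s.
  have -> : s = phi 2^-1 * (W + 2 * p ^+ 2 - P).
    by rewrite fmorphV rmorph_nat /P PE /W; field; apply: natL 1.
  by do ?[exact: natS | exact: phiS | exact: p_stable | exact: W_stable
    | apply: span_stableX | apply: span_stableD | apply: span_stableM
    | apply: span_stableN].
case=> [[|[|[|[|//]]]] lt_i4].
- by rewrite (_ : Ordinal lt_i4 = 0) //; apply: val_inj.
- by rewrite (_ : Ordinal lt_i4 = 1) //; apply: val_inj.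
- by rewrite (_ : Ordinal lt_i4 = 2) //; apply: val_inj.
- by rewrite (_ : Ordinal lt_i4 = 3) //; apply: val_inj.
Qed.

Lemma g_2_surj y : X_Q R y -> exists x, fiber (X_Q R) (g_2 R) y x.
Proof.
move=> /X_Q_param [u [v [uE uvE vE]]].
have [[|x s] [fE s8 _]] := g_2_fiber_seq y`_0 u v; first by [].
exists x; rewrite [y]tuple4_eta -uE -uvE -vE fE /=.
by rewrite inE eqxx.
Qed.

Lemma g_2_degree : has_degree (X_Q R) (X_Q R) (g_2 R) 8%N /\
  forall d, has_degree (X_Q R) (X_Q R) (g_2 R) d -> d = 8%N.
Proof.
have <- : #|{: 'I_4 * bool}| = 8%N by rewrite card_prod card_bool card_ord.
apply: (@has_degree_basis R 4 4 _ _ _ _ basis4 (0, false)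
  ('X_1 * ('X_0 ^+ 2 - 'X_3) * A_h R)).
- exact: X_Q_curve_connected.
- exact: X_Q_curve_connected.
- by move=> x; apply: g_2_X_Q.
- exact: g_2_surj.
(* Here [A_h] takes the value 316 and [q (p^2 - s)] the value -1. *)
- exists [tuple 0; 1; 1; 1]; first by apply/X_QP => /=; ring.
  rewrite !mevalM meval_A_h mevalB rmorphXn /= !meval_nth /=.
  rewrite [X in X != 0](_ : _ = - 316%:R) ?oppr_eq0 ?natC_neq0 //.
  by rewrite /discA; ring.
- by move=> y Yy Dy c; apply: g_2_generic_free.
- by rewrite /basis4 !expr0 mulr1.
- by move=> K L rhoY rhoX phi KY LX phiE; exact: (g_2_span_stable KY LX phiE).
Qed.

Lemma g_2_branch_locus :
  branch_locus (X_Q R) (X_Q R) (g_2 R) = L_1 R `|` S_P R `|` S_A R.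
Proof.
have [deg8 deg_uniq] := g_2_degree.
apply: branch_locus_eq => y.
  move=> [[/L_1P [h1 h2 h3]|/S_PP [_ h]]|/S_AP [_ h]]; apply/X_QP; rewrite //.
  by rewrite h1 h2 h3; ring.
move=> Yy; have [u [v [uE uvE vE]]] := X_Q_param Yy.
have [s [fE s8 sU]] := g_2_fiber_seq y`_0 u v.
rewrite uE uvE vE -tuple4_eta in fE sU.
rewrite (branch_locusP deg8 deg_uniq Yy fE s8) sU.
rewrite -[(_ `|` _) y]/((L_1 R y \/ S_P R y) \/ S_A R y) L_1P S_PP S_AP; split.
  rewrite !negb_and negb_or !negbK => /or3P [/andP [/eqP u0 /eqP v0]|/eqP ->|/eqP ->].
  - by left; left; rewrite -uE -uvE -vE u0 v0; split; ring.
  - by left; right; split=> //; apply/X_QP.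
  - by right; split=> //; apply/X_QP.
case=> [[[u0 _ v0]|[-> _]]|[-> _]]; last by rewrite eqxx !andbF.
  move: uE vE; rewrite u0 v0 => /eqP; rewrite sqrf_eq0 => /eqP -> /eqP.
  by rewrite sqrf_eq0 => /eqP ->; rewrite eqxx.
by rewrite eqxx andbF.
Qed.

End G2.

Theorem proposition4p12 (R : realType) :
  branch_locus (X_Q R) (X_Q R) (g_2 R) = L_1 R `|` S_P R `|` S_A R /\
  branch_locus [set: 3.-tuple R[i]] (X_Q R) (Ftilde R) = L_1 R `|` S_P R.
Proof. by split; [apply: g_2_branch_locus | apply: Ftilde_branch_locus]. Qed.
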